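(* Let $(S,\mathcal{B})$ be a standard Borel space and let $X=(X_1,X_2,\ldots)$ be a sequence of $S$-valued random variables on a probability space $(\Omega,\mathcal{A},P)$, with predictive distributions $\alpha_n$, $n\ge 0$. Let $\mathcal{T}=\bigcap_n\sigma(X_n,X_{n+1},\ldots)$ be the tail $\sigma$-field of $X$. Suppose that, for each $f\in M_b(S)$, the sequence $\alpha_n(f)$ converges in probability as $n\to\infty$. Then there is a random probability measure $\alpha$ on $\mathcal{B}$ such that $\alpha$ is $\mathcal{T}$-measurable and $\alpha_n(f)\to\alpha(f)$ in probability, as $n\to\infty$, for each $f\in M_b(S)$.
   Context: A standard Borel space $(S,\mathcal{B})$ here means that $S$ is a Borel subset of some Polish space and $\mathcal{B}$ is the Borel $\sigma$-field on $S$. $M_b(S)$ is the set of real bounded $\mathcal{B}$-measurable functions on $S$. Set $\mathcal{F}_0=\{\emptyset,\Omega\}$ and $\mathcal{F}_n=\sigma(X_1,\ldots,X_n)$ for $n\ge 1$. A random probability measure on $\mathcal{B}$ is a map $\alpha$ on $\Omega\times\mathcal{B}$ such that $\alpha(\omega,\cdot)$ is a probability measure on $\mathcal{B}$ for each fixed $\omega\in\Omega$, and $\omega\mapsto\alpha(\omega,B)$ is $\mathcal{A}$-measurable for each fixed $B\in\mathcal{B}$. For $f\in M_b(S)$, $\alpha(f)$ denotes the real random variable $\omega\mapsto\int f(x)\,\alpha(\omega,dx)$. Given a sub-$\sigma$-field $\mathcal{G}\subset\mathcal{A}$, $\alpha$ is $\mathcal{G}$-measurable if $\omega\mapsto\alpha(\omega,B)$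 is $\mathcal{G}$-measurable for each fixed $B\in\mathcal{B}$. The predictive distributions of $X$ are the random probability measures $\alpha_n(\cdot)=P(X_{n+1}\in\cdot\mid\mathcal{F}_n)$, $n\ge 0$ (regular conditional distributions), so that $\alpha_n(f)=E\{f(X_{n+1})\mid\mathcal{F}_n\}$ a.s. for each $f\in M_b(S)$. *)

(* Defs.v *)
From HB Require Import structures.
From mathcomp Require Import all_boot all_order all_algebra.
From mathcomp Require Import all_classical all_reals all_analysis.
From mathcomp Require Import measurable_realfun.

Set Implicit Arguments.
Unset Strict Implicit.
Unset Printing Implicit Defensive.

Import Order.TTheory GRing.Theory Num.Theory.
Import numFieldNormedType.Exports.

Local Open Scope classical_set_scope.
Local Open Scope ring_scope.

(* A Polish space, presented by a complete separable metric inducing its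
   topology; only the topology is used below. *)
Definition polish {R : realType} (T : metricType R) : Prop :=
  (forall F : set_system T, ProperFilter F -> cauchy F -> exists x : T, F --> x) /\
  (exists2 D : set T, countable D & dense D).

(* [S] is identified with the Borel subset [range i] of a Polish space [T]:
   the measurable sets of [S] are exactly the traces on it of the Borel sets
   of [T]. *)
Definition standard_borel (R : realType) d (S : measurableType d) : Prop :=
  exists (T : metricType R) (i : S -> T),
    [/\ polish T,
        injective i,
        <<s open >> (range i) &
        @measurable d S = preimage_set_system [set: S] i <<s open >>].

Definition sigma_seq {d d'} {Omega : measurableType d} {S : measurableType d'}
    (X : nat -> Omega -> S) (K : set nat) : set (set Omega) :=
  <<s \bigcup_(k in K) preimage_set_system [set: Omega] (X k) measurable >>.

(* The sequence is indexed from 0: [X k] stands for X_{k+1}, so that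
   [past X n] is the sigma-field of X_1, ..., X_n, trivial when n = 0. *)
Definition past {d d'} {Omega : measurableType d} {S : measurableType d'}
    (X : nat -> Omega -> S) (n : nat) : set (set Omega) :=
  sigma_seq X [set k | (k < n)%N].

Definition tail_sigma {d d'} {Omega : measurableType d}
    {S : measurableType d'} (X : nat -> Omega -> S) : set (set Omega) :=
  \bigcap_n sigma_seq X [set k | (n <= k)%N].

(* A random probability measure on [S] is a probability kernel
   [R.-pker Omega ~> S]. *)
Definition rpm_measurable {R : realType} {d d'} {Omega : measurableType d}
    {S : measurableType d'} (G : set (set Omega))
    (alpha : R.-pker Omega ~> S) : Prop :=
  forall B : set S, measurable B -> forall C : set (\bar R), measurable C ->
    G [set w | C (alpha w B)].

(* [alpha] is a regular version of P(Y \in . | G); [G] is meant to be a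
   sub-sigma-field. *)
Definition rcd {R : realType} {d d'} {Omega : measurableType d}
    {S : measurableType d'} (P : probability Omega R) (G : set (set Omega))
    (Y : Omega -> S) (alpha : R.-pker Omega ~> S) : Prop :=
  rpm_measurable G alpha /\
  forall B : set S, measurable B -> forall A : set Omega, G A ->
    (\int[P]_(w in A) alpha w B = P (A `&` Y @^-1` B))%E.

Definition predictive {R : realType} {d d'} {Omega : measurableType d}
    {S : measurableType d'} (P : probability Omega R) (X : nat -> Omega -> S)
    (alpha : nat -> R.-pker Omega ~> S) : Prop :=
  forall n, rcd P (past X n) (X n) (alpha n).

Definition rpm_int {R : realType} {d d'} {Omega : measurableType d}
    {S : measurableType d'} (alpha : R.-pker Omega ~> S) (f : S -> R) :
    Omega -> R :=
  fun w => \int[alpha w]_x f x.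

(* For measurable [Y n] and [Z]. *)
Definition cvg_in_probability {R : realType} {d} {Omega : measurableType d}
    (P : probability Omega R) (Y : nat -> Omega -> R) (Z : Omega -> R) : Prop :=
  forall e : R, 0 < e ->
    P [set w | e <= `|Y n w - Z w|] @[n --> \oo] --> 0%E.

(* Main.v *)
(* For a measurable set B let p_n = alpha_n(B) and I_n the indicator of
   {X_{n+1} in B}. The differences I_n - p_n are orthogonal, so the empirical
   means of (I_n) have the same L^1 limit as (p_n). Dropping the first k terms
   of the k-th mean of a fast subsequence and taking the limsup yields a version
   W_B of that limit which is measurable for the tail sigma-field itself, not
   only for its completion. Next, E W_B = lim P(X_n in B) for every B, and a
   setwise limit of probability measures is countably additive (Nikodym), which
   makes B |-> W_B countably additive in L^1. Finally S is a measurable retract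
   of the real line: phi : S -> [0, 1] records in ternary digits which balls
   around a dense sequence contain a point, and psi recovers the point by
   completeness. Hence it suffices to build a kernel on the line: the quantile
   function of q |-> W_{phi <= q}, q rational, pushes the uniform law to a tail
   measurable random law on the line, and its image under psi is alpha. The
   identification with W_B goes through the pi-lambda theorem. *)
Require Import Defs.
From HB Require Import structures.
From mathcomp Require Import all_boot all_order all_algebra.
From mathcomp Require Import all_classical all_reals all_analysis.
From mathcomp Require Import measurable_realfun.
From mathcomp Require Import ring lra.

Set Implicit Arguments.
Unset Strict Implicit.
Unset Printing Implicit Defensive.

Import Order.TTheory GRing.Theory Num.Theory.
Import numFieldNormedType.Exports.

Local Open Scope classical_set_scope.
Local Open Scope ring_scope.

(** * Bounded random variables and convergence in the mean *)

(** Each [W_B] is determined only up to a null set depending on [B], while a kernel must work at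
    every [w] for all [B] at once, and repairs on null sets could leave the tail sigma-field. Hence
    versions are fixed only for the countably many events [phi <= q]; chosen independently, they may
    fail to be monotone in [q] at some [w]. The quantile construction takes such a family as it is:
    at every [w] it yields a law on the line whose mass of []-oo, x[] is the supremum of the
    versions with [q < x], and no exceptional set is cut out. Nikodym's theorem makes that supremum
    the right limit: convergence for each fixed event does not by itself allow the limit in [n] to
    be exchanged with a monotone limit of events, and smallness uniform in [n] supplies the
    exchange. The decoder [psi] is total on the line, so the random law has an image on [S] wherever
    its mass sits. *)

Section layers.
Context {R : realType}.
Implicit Types (z : R) (m : nat).

(** The sum is the integer part of (m+1) z. Cutting a bounded variable into its level sets in this
    way carries identities and limits from events to functions, with a uniform error. *)
Lemma layer_approx z m : 0 <= z <= 1 ->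
  `|z - m.+1%:R^-1 * \sum_(k < m.+1) (k.+1%:R / m.+1%:R <= z)%R%:R|
     <= m.+1%:R^-1.
Proof.
move=> /andP[z0 z1].
have m0 : 0 < m.+1%:R :> R by rewrite ltr0n.
(* The partial sum is the minimum of [n] and the integer part of (m+1) z; the two cases express what
   is needed of this by inequalities alone. *)
suff H n : (n <= m.+1)%N -> let s := \sum_(k < n) ((k.+1%:R / m.+1%:R <= z)%R%:R : R) in
    (n%:R <= m.+1%:R * z -> s = n%:R) /\
    (m.+1%:R * z < n%:R -> s <= m.+1%:R * z <= s + 1).
  have /= [H1 H2] := H _ (leqnn m.+1).
  rewrite -[X in _ <= X]mulr1 -[X in `|X - _|](mulKf (lt0r_neq0 m0)) -mulrBr normrM.
  rewrite gtr0_norm ?invr_gt0// ler_pM2l ?invr_gt0// ler_norml.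
  have [mz|/H2/andP[]] := leP m.+1%:R (m.+1%:R * z); last first.
    move=> s1 s2; apply/andP; split; lra.
  have := mz; rewrite -{1}[m.+1%:R]mulr1 ler_pM2l// => z1'.
  have -> : z = 1 by lra.
  rewrite mulr1; have := H1 mz; have -> : z = 1 by lra.
  by move=> ->; rewrite subrr; apply/andP; split; lra.
elim: n => [|n IH] nm /=.
  by rewrite big_ord0; split => // h; have := mulr_ge0 (ltW m0) z0; lra.
have /= [IH1 IH2] := IH (ltnW nm).
rewrite big_ord_recr/= ler_pdivrMr// [z * _]mulrC.
split=> [h|h].
  rewrite h IH1; first by rewrite -natr1.
  by apply: le_trans h; rewrite ler_nat.
have /negbTE -> : ~~ (n.+1%:R <= m.+1%:R * z) by rewrite -ltNge.
rewrite addr0.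
have [h'|h'] := leP n%:R (m.+1%:R * z); last exact: IH2.
by rewrite IH1// h'/= ltW// natr1.
Qed.

End layers.

Section expectation.
Context d {T : measurableType d} {R : realType} (P : probability T R).
Implicit Types (f g h : T -> R).

(** A class closed under products, which integrability is not; the side conditions of the
    expectation lemmas then follow by closure. *)
Definition bmeas d' (T' : measurableType d') (f : T' -> R) :=
  measurable_fun setT f /\ exists M, forall x, `|f x| <= M.

Lemma bmeas_integrable f : bmeas f -> P.-integrable setT (EFin \o f).
Proof.
move=> [mf [M fM]]; apply: measurable_bounded_integrable => //.
  by rewrite (le_lt_trans (probability_le1 _ _))// ltry.
by exists M; split; [exact: num_real|move=> x Mx y _ /=; rewrite (le_trans (fM y))// ltW].
Qed.

Lemma bmeasD f g : bmeas f -> bmeas g -> bmeas (fun x => f x + g x).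
Proof.
move=> [mf [M fM]] [mg [N gN]]; split; first exact: measurable_funD.
by exists (M + N) => x; rewrite (le_trans (ler_normD _ _))// lerD.
Qed.

Lemma bmeasB f g : bmeas f -> bmeas g -> bmeas (fun x => f x - g x).
Proof.
move=> [mf [M fM]] [mg [N gN]]; split; first exact: measurable_funB.
by exists (M + N) => x; rewrite (le_trans (ler_normB _ _))// lerD.
Qed.

Lemma bmeasM f g : bmeas f -> bmeas g -> bmeas (fun x => f x * g x).
Proof.
move=> [mf [M fM]] [mg [N gN]]; split; first exact: measurable_funM.
by exists (M * N) => x; rewrite normrM ler_pM.
Qed.

Lemma bmeas_norm f : bmeas f -> bmeas (fun x => `|f x|).
Proof.
move=> [mf [M fM]]; split; first exact: measurableT_comp.
by exists M => x; rewrite normr_id.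
Qed.

Lemma bmeas_cst (r : R) : bmeas (fun _ : T => r).
Proof. by split; [exact: measurable_cst|exists `|r|]. Qed.

Lemma bmeasZ r f : bmeas f -> bmeas (fun x => r * f x).
Proof. by move=> ?; apply: bmeasM => //; exact: bmeas_cst. Qed.

Lemma bmeas_sum n (F : nat -> T -> R) : (forall k, bmeas (F k)) ->
  bmeas (fun x => \sum_(k < n) F k x).
Proof.
move=> bF; elim: n => [|n IH].
  by under eq_fun do rewrite big_ord0; exact: bmeas_cst.
by under eq_fun do rewrite big_ord_recr/=; exact: bmeasD.
Qed.

Lemma bmeas_indic A : measurable A -> bmeas (\1_A : T -> R).
Proof.
move=> mA; split; first exact: measurable_indic.
by exists 1 => x; rewrite indicE; case: (_ \in _); rewrite ?normr1 ?normr0.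
Qed.

Lemma expD f g : bmeas f -> bmeas g ->
  \int[P]_x (f x + g x) = \int[P]_x f x + \int[P]_x g x.
Proof. by move=> bf bg; rewrite RintegralD//; exact: bmeas_integrable. Qed.

Lemma expB f g : bmeas f -> bmeas g ->
  \int[P]_x (f x - g x) = \int[P]_x f x - \int[P]_x g x.
Proof. by move=> bf bg; rewrite RintegralB//; exact: bmeas_integrable. Qed.

Lemma expZ r f : bmeas f -> \int[P]_x (r * f x) = r * \int[P]_x f x.
Proof. by move=> bf; rewrite RintegralZl//; exact: bmeas_integrable. Qed.

Lemma exp_cst r : \int[P]_x r = r.
Proof.
have h : fine (P [set: T]) = 1 by rewrite probability_setT.
rewrite (Rintegral_cst _ measurableT).
exact: (etrans (congr1 ( *%R r) h) (mulr1 r)).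
Qed.

Lemma exp_le f g : bmeas f -> bmeas g -> (forall x, f x <= g x) ->
  \int[P]_x f x <= \int[P]_x g x.
Proof. by move=> bf bg fg; apply: le_Rintegral => //; exact: bmeas_integrable. Qed.

Lemma exp_norm f : bmeas f -> `|\int[P]_x f x| <= \int[P]_x `|f x|.
Proof. by move=> bf; apply: le_normr_Rintegral => //; exact: bmeas_integrable. Qed.

Lemma exp_indic A : measurable A -> \int[P]_x (\1_A x : R) = fine (P A).
Proof. by move=> mA; rewrite /Rintegral integral_indic// setIT. Qed.

Lemma exp_sum n (F : nat -> T -> R) : (forall k, bmeas (F k)) ->
  \int[P]_x (\sum_(k < n) F k x) = \sum_(k < n) \int[P]_x F k x.
Proof.
move=> bF; elim: n => [|n IH].
  by under eq_Rintegral do rewrite big_ord0; rewrite exp_cst big_ord0.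
under eq_Rintegral do rewrite big_ord_recr/=.
by rewrite expD ?IH ?big_ord_recr//; exact: bmeas_sum.
Qed.

Lemma exp_eq0_null h : bmeas h -> (forall x, 0 <= h x) -> \int[P]_x h x = 0 ->
  P [set x | 0 < h x] = 0%E.
Proof.
move=> bh h0 Eh.
have mh : measurable_fun setT (EFin \o h) by apply/measurable_EFinP; case: bh.
have /(ae_eq_integral_abs P measurableT mh) : (\int[P]_x `|(EFin \o h) x|)%E = 0%E.
  under eq_integral do rewrite gee0_abs ?lee_fin//=.
  move: Eh; rewrite /Rintegral => Eh; rewrite -[LHS]fineK ?Eh//.
  by apply: integrable_fin_num => //; exact: bmeas_integrable.
move=> [N [mN N0 hN]]; apply/eqP; rewrite eq_le measure_ge0 andbT -N0.
apply: le_measure; rewrite ?inE//.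
  rewrite (_ : [set _ | _] = h @^-1` `]0, +oo[).
    by rewrite -[X in measurable X]setTI; apply: bh.1 => //; exact: measurable_itv.
  by apply/seteqP; split=> x /=; rewrite in_itv/= andbT.
apply: subset_trans hN => x /= hx /(_ I)[] h0'.
by move: hx; rewrite h0' ltxx.
Qed.

Definition L1cvg (Y : nat -> T -> R) (Z : T -> R) :=
  (fun n => \int[P]_x `|Y n x - Z x|) @ \oo --> (0 : R).

Lemma L1cvgP Y Z : L1cvg Y Z <->
  forall e, 0 < e -> exists N, forall n, (N <= n)%N -> \int[P]_x `|Y n x - Z x| <= e.
Proof.
split.
  move=> /cvgrPdist_le YZ e e0; have [N _ HN] := YZ e e0.
  exists N => n Nn; have := HN n Nn; rewrite sub0r normrN => /(le_trans _); apply.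
  exact: ler_norm.
move=> H; apply/cvgrPdist_le => e e0; have [N HN] := H e e0.
exists N => // n /= Nn; rewrite sub0r normrN ger0_norm; first exact: HN.
by apply: Rintegral_ge0.
Qed.

Lemma measurable_ge h e : measurable_fun setT h -> measurable [set x | e <= h x].
Proof.
move=> mh; rewrite (_ : [set _ | _] = h @^-1` `[e, +oo[).
  by rewrite -[X in measurable X]setTI; apply: mh => //; exact: measurable_itv.
by apply/seteqP; split=> x /=; rewrite in_itv/= andbT.
Qed.

Lemma markov_bmeas h e : bmeas h -> 0 < e ->
  fine (P [set x | e <= `|h x|]) <= e^-1 * \int[P]_x `|h x|.
Proof.
move=> bh e0; have mA := measurable_ge e (bmeas_norm bh).1.
rewrite -exp_indic// -expZ; last exact: bmeas_norm.
apply: exp_le; [exact: bmeas_indic|by apply: bmeasZ; exact: bmeas_norm|].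
move=> x; rewrite indicE; case: (boolP (_ \in _)) => [|_].
  by rewrite inE/= => ex; rewrite ler_pdivlMl// mulr1.
by rewrite mulr_ge0// invr_ge0 ltW.
Qed.

Lemma L1cvg_in_probability (Y : nat -> T -> R) (Z : T -> R) :
  (forall n, bmeas (fun x => Y n x - Z x)) ->
  L1cvg Y Z -> cvg_in_probability P Y Z.
Proof.
move=> bYZ /L1cvgP YZ e e0.
have fP n : P [set w | e <= `|Y n w - Z w|] \is a fin_num.
  by apply: fin_num_measure; exact: (measurable_ge e (bmeas_norm (bYZ n)).1).
apply/fine_cvgP; split; first exact: nearW.
apply/cvgrPdist_le => r r0; have [N HN] := YZ _ (mulr_gt0 e0 r0).
exists N => // n /= Nn; rewrite sub0r normrN ger0_norm ?fine_ge0//.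
apply: (le_trans (markov_bmeas (bYZ n) e0)).
by rewrite ler_pdivrMl// HN.
Qed.

Lemma cvg_in_probability_L1 (M : R) (Y : nat -> T -> R) (Z : T -> R) :
  (forall n, measurable_fun setT (fun x => Y n x - Z x)) ->
  (forall n x, `|Y n x - Z x| <= M) ->
  cvg_in_probability P Y Z -> L1cvg Y Z.
Proof.
move=> mYZ YZM YZ; apply/L1cvgP => e e0.
have M0 : 0 <= M.
  have [x _] : [set: T] !=set0.
    apply/set0P/eqP => T0; have := probability_setT P; rewrite T0 measure0.
    by move=> /eqP; rewrite eq_sym onee_eq0.
  by rewrite (le_trans _ (YZM 0%N x)).
have bYZ n : bmeas (fun x => Y n x - Z x) by split => //; exists M.
have e2 : 0 < e / 2 by rewrite divr_gt0.
(* [M + 1] rather than [M] keeps the divisor below positive when [M] is zero. *)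
have M1 : 0 < M + 1 by rewrite ltr_wpDl.
have /fine_cvgP[_ /cvgrPdist_le] := YZ _ e2.
move=> /(_ (e / 2 / (M + 1)) (divr_gt0 e2 M1))[N _ HN].
exists N => n Nn; have := HN n Nn; rewrite sub0r normrN ger0_norm ?fine_ge0// => PA.
have mA := measurable_ge (e / 2) (bmeas_norm (bYZ n)).1.
apply: (@le_trans _ _ (\int[P]_x (e / 2 + M * \1_[set w | e / 2 <= `|Y n w - Z w|] x))).
  apply: exp_le; [exact: bmeas_norm| |].
    by apply: bmeasD; [exact: bmeas_cst|apply: bmeasZ; exact: bmeas_indic].
  move=> x; rewrite indicE; case: (boolP (_ \in _)) => [_|].
    by rewrite mulr1 ler_wpDl// ltW.
  by rewrite notin_setE/= mulr0 addr0 => /negP; rewrite -ltNge => /ltW.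
rewrite expD; [|exact: bmeas_cst|by apply: bmeasZ; exact: bmeas_indic].
rewrite exp_cst expZ; last exact: bmeas_indic.
rewrite exp_indic// [leRHS](splitr e) lerD2l.
apply: (le_trans (ler_wpM2l M0 PA)); rewrite mulrCA ler_piMr// ?ltW//.
by rewrite ltr_pdivrMr// mul1r ltrDl.
Qed.

End expectation.

Section kernel_probability.
Context {R : realType} d d' {T : measurableType d} {S : measurableType d'}.
Variable k : R.-pker T ~> S.
Implicit Types A B : set S.

Definition kprob B w := fine (k w B).

Lemma kernel_le1 w B : measurable B -> (k w B <= 1)%E.
Proof. by move=> mB; rewrite -(@prob_kernel _ _ _ _ _ k w) le_measure ?inE. Qed.

Lemma kprobE w B : measurable B -> k w B = (kprob B w)%:E.
Proof.
move=> mB; rewrite fineK// fin_numElt (lt_le_trans _ (measure_ge0 _ _))//=.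
by rewrite (le_lt_trans (kernel_le1 _ mB))// ltry.
Qed.

Lemma kprob01 B w : measurable B -> 0 <= kprob B w <= 1.
Proof. by move=> mB; rewrite -!lee_fin -kprobE// measure_ge0 kernel_le1. Qed.

Lemma measurable_kprob B : measurable B -> measurable_fun setT (kprob B).
Proof. by move=> mB; apply: measurableT_comp => //; exact: measurable_kernel. Qed.

Lemma bmeas_kprob B : measurable B -> bmeas (kprob B).
Proof.
move=> mB; split; first exact: measurable_kprob.
by exists 1 => w; have /andP[] := kprob01 w mB => ? ?; rewrite ger0_norm.
Qed.

Lemma kprob_setT w : kprob setT w = 1.
Proof. by rewrite /kprob prob_kernel. Qed.

Lemma kprob_set0 w : kprob set0 w = 0.
Proof. by rewrite /kprob measure0. Qed.

Lemma kprob_setD A B w : measurable A -> measurable B -> B `<=` A ->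
  kprob (A `\` B) w = kprob A w - kprob B w.
Proof.
move=> mA mB BA; apply: EFin_inj; rewrite EFinB -!kprobE//; last exact: measurableD.
by rewrite measureD// ?(setIidr BA)// (le_lt_trans (kernel_le1 _ mA))// ltry.
Qed.

Lemma kprob_le A B w : measurable A -> measurable B -> A `<=` B ->
  kprob A w <= kprob B w.
Proof. by move=> mA mB AB; rewrite -lee_fin -!kprobE// le_measure ?inE. Qed.

Lemma rpm_int_indic B w : measurable B -> rpm_int k \1_B w = kprob B w.
Proof. by move=> mB; rewrite /rpm_int /Rintegral integral_indic// setIT. Qed.

End kernel_probability.

Section sigma_seq.
Context d d' {Omega : measurableType d} {S : measurableType d'}.
Variable X : nat -> Omega -> S.

Lemma sigma_algebra_sigma_seq K : sigma_algebra setT (sigma_seq X K).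
Proof. exact: smallest_sigma_algebra. Qed.

Lemma sigma_algebra_tail_sigma : sigma_algebra setT (tail_sigma X).
Proof. by apply: sigma_algebra_bigcap => n _; exact: sigma_algebra_sigma_seq. Qed.

Lemma sigma_seqS K L : K `<=` L -> sigma_seq X K `<=` sigma_seq X L.
Proof.
move=> KL; apply: sub_sigma_algebra2; exact: bigcup_subset.
Qed.

Lemma sigma_seq_preimage (K : set nat) k (B : set S) : K k -> measurable B ->
  sigma_seq X K (X k @^-1` B).
Proof.
by move=> Kk mB; apply: sub_sigma_algebra; exists k => //; exists B => //; rewrite setTI.
Qed.

Lemma sigma_seq_measurable K : (forall k, measurable_fun setT (X k)) ->
  sigma_seq X K `<=` measurable.
Proof.
move=> mX; apply: smallest_sub; first exact: sigma_algebra_measurable.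
by move=> _ [k _ [B mB <-]]; exact: mX.
Qed.

End sigma_seq.

(** * Orthogonality of the prediction errors *)

Section orthogonality.
Context {R : realType} d d' {Omega : measurableType d} {S : measurableType d'}.
Variables (P : probability Omega R).

(** [rcd] yields the identity against indicators of sets of [G]. It passes to [Z] by uniform
    approximation with averages of indicators of the level sets of [Z], hence the form of the last
    hypothesis. *)
Lemma rcd_orthogonal (G : set (set Omega)) (Y : Omega -> S)
    (alpha : R.-pker Omega ~> S) (B : set S) (Z : Omega -> R) :
  G `<=` measurable -> measurable_fun setT Y -> measurable B -> rcd P G Y alpha ->
  bmeas Z -> (forall w, 0 <= Z w <= 1) -> (forall c, G [set w | c <= Z w]) ->
  \int[P]_w (Z w * (\1_(Y @^-1` B) w - kprob alpha B w)) = 0.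
Proof.
move=> Gm mY mB [_ Grcd] bZ Z01 GZ.
have mYB : measurable (Y @^-1` B) by rewrite -[X in measurable X]setTI; exact: mY.
set D := fun w => \1_(Y @^-1` B) w - kprob alpha B w.
have bI : bmeas (\1_(Y @^-1` B) : _ -> R) by exact: bmeas_indic.
have bK := bmeas_kprob alpha mB.
have bD : bmeas D by exact: bmeasB.
have D1 w : `|D w| <= 1.
  rewrite /D indicE; have /andP[] := kprob01 alpha w mB.
  by case: (_ \in _) => /=; rewrite ler_norml => ? ?; apply/andP; split; lra.
have ED A : G A -> \int[P]_w (\1_A w * D w) = 0.
  move=> GA; have mA := Gm _ GA.
  have -> : (fun w => \1_A w * D w) =
      (fun w => \1_(A `&` Y @^-1` B) w - \1_A w * kprob alpha B w).
    by apply/funext => w; rewrite /D mulrBr indicI.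
  rewrite expB; last 2 first.
    by apply: bmeas_indic; exact: measurableI.
    by apply: bmeasM => //; exact: bmeas_indic.
  rewrite exp_indic; last exact: measurableI.
  apply/eqP; rewrite subr_eq0; apply/eqP; congr fine.
  rewrite -Grcd// [LHS]integral_mkcond; apply: eq_integral => w _.
  rewrite patchE indicE; case: (_ \in _); rewrite ?mul1r ?mul0r//.
  exact: kprobE.
apply/eqP; rewrite -normr_le0; apply/ler_addgt0Pl => e e0; rewrite addr0.
have [m me] : exists m : nat, (m.+1%:R : R)^-1 <= e.
  by have [m] := ltr_add_invr e0; rewrite add0r => /ltW ?; exists m.
pose L w : R := m.+1%:R^-1 * \sum_(k < m.+1) (k.+1%:R / m.+1%:R <= Z w)%R%:R.
have LE : L = fun w => m.+1%:R^-1 * \sum_(k < m.+1) \1_[set w | k.+1%:R / m.+1%:R <= Z w] w.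
  apply/funext => w; congr (_ * _); apply: eq_bigr => k _.
  rewrite indicE; congr (_%:R); congr nat_of_bool.
  by apply/idP/idP; rewrite inE.
have bL : bmeas L.
  rewrite LE; apply: bmeasZ; apply: (@bmeas_sum _ _ _ m.+1 (fun k => \1_[set w | k.+1%:R / m.+1%:R <= Z w])).
  by move=> k; apply: bmeas_indic; exact: Gm.
have EL : \int[P]_w (L w * D w) = 0.
  rewrite LE.
  under eq_Rintegral do rewrite -mulrA mulr_suml.
  rewrite expZ.
    rewrite (@exp_sum _ _ _ _ m.+1 (fun k w => \1_[set w | k.+1%:R / m.+1%:R <= Z w] w * D w)).
      by rewrite big1 ?mulr0// => k _; exact: ED.
    by move=> k; apply: bmeasM => //; apply: bmeas_indic; exact: Gm.
  apply: (@bmeas_sum _ _ _ m.+1 (fun k w => \1_[set w | k.+1%:R / m.+1%:R <= Z w] w * D w)).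
  by move=> k; apply: bmeasM => //; apply: bmeas_indic; exact: Gm.
rewrite -[X in `|X|]subr0 -[X in _ - X]EL -expB; [|exact: bmeasM..].
apply: le_trans me; rewrite -[leRHS](exp_cst P).
apply: (le_trans (exp_norm _ _)); first by apply: bmeasB; exact: bmeasM.
apply: exp_le; [|exact: bmeas_cst|].
  by apply: bmeas_norm; apply: bmeasB; exact: bmeasM.
move=> w; rewrite -mulrBl normrM -[leRHS]mulr1 ler_pM//.
  exact: layer_approx.
exact: D1.
Qed.

End orthogonality.

(** * Tail measurable limits *)

Section empirical_means.
Context {R : realType} d d' {Omega : measurableType d} {S : measurableType d'}.
Variables (P : probability Omega R) (X : nat -> Omega -> S).
Hypothesis mX : forall n, measurable_fun setT (X n).
Variable alpha : nat -> R.-pker Omega ~> S.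
Hypothesis pX : predictive P X alpha.
Variables (B : set S) (mB : measurable B).

Let I n : Omega -> R := \1_(X n @^-1` B).
Let D n w := I n w - kprob (alpha n) B w.

Let mXB n : measurable (X n @^-1` B).
Proof. by rewrite -[X in measurable X]setTI; exact: mX. Qed.

Let bI n : bmeas (I n). Proof. exact: bmeas_indic. Qed.

Let bK n : bmeas (kprob (alpha n) B). Proof. exact: bmeas_kprob. Qed.

Let bD n : bmeas (D n). Proof. exact: bmeasB. Qed.

Let I01 n w : 0 <= I n w <= 1.
Proof. by rewrite /I indicE; case: (_ \in _); rewrite /= ?lexx ?ler01. Qed.

Let D1 n w : `|D n w| <= 1.
Proof.
have /andP[? ?] := I01 n w; have /andP[? ?] := kprob01 (alpha n) w mB.
by rewrite ler_norml /D; apply/andP; split; lra.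
Qed.

Lemma exp_predictive n : \int[P]_w kprob (alpha n) B w = fine (P (X n @^-1` B)).
Proof.
have [_ h] := pX n; have := h _ mB setT; rewrite setTI => <-; last first.
  by case: (sigma_algebra_dynkin (sigma_algebra_sigma_seq X [set k | (k < n)%N])).
by congr fine; apply: eq_integral => w _; rewrite kprobE.
Qed.

Let D_orthogonal i j : (i < j)%N -> \int[P]_w (D i w * D j w) = 0.
Proof.
move=> ij; have orth Z := @rcd_orthogonal _ _ _ _ _ P _ _ _ _ Z
  (sigma_seq_measurable mX) (mX j) mB (pX j).
have iK : past X i `<=` past X j.
  by apply: sigma_seqS => k /= /ltn_trans; apply.
(* [D i] changes sign, while [rcd_orthogonal] takes factors in [[0, 1]]: the two terms of [D i] are
   treated separately, both being measurable for [past X j]. *)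
under eq_Rintegral do rewrite {1}/D mulrBl.
rewrite expB; [|exact: bmeasM..].
rewrite orth//; last 1 first.
- move=> c; have [c0|c0] := leP c 0.
    rewrite (_ : [set w | c <= I i w] = setT); first exact: (dynkinT (sigma_algebra_dynkin (sigma_algebra_sigma_seq X [set k | (k < j)%N]))).
    apply/seteqP; split=> // w _ /=; apply: (le_trans c0).
    by have /andP[] := I01 i w.
  have [c1|c1] := leP c 1.
    rewrite (_ : [set w | c <= I i w] = X i @^-1` B); first exact: sigma_seq_preimage.
    apply/seteqP; split=> w /=; rewrite /I indicE.
      by case: (boolP (w \in _)) => [/set_mem//|_]; rewrite leNgt c0.
    by move=> wB; rewrite mem_set.
  rewrite (_ : [set w | c <= I i w] = set0); first exact: sigma_algebra0.
  apply/seteqP; split=> // w /=; have /andP[_ I1] := I01 i w.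
  by move=> /le_trans/(_ I1); rewrite leNgt c1.
rewrite orth ?subrr//.
- by move=> w; exact: kprob01.
- move=> c; apply: iK; have [m _] := pX i.
  rewrite (_ : [set w | c <= kprob (alpha i) B w] = [set w | [set x | (c%:E <= x)%E] (alpha i w B)]).
    apply: m => //; rewrite (_ : [set _ | _] = [set` `[c%:E, +oo[]).
      exact: emeasurable_itv.
    by apply/seteqP; split=> x /=; rewrite in_itv/= andbT.
  by apply/seteqP; split=> w /=; rewrite kprobE// lee_fin.
Qed.

Let S_ n w := \sum_(i < n) D i w.

Let bS n : bmeas (S_ n). Proof. exact: bmeas_sum. Qed.

(** Orthogonality removes the cross term, so each step adds only the second moment of one difference
    bounded by 1. *)
Let exp_sqrS n : \int[P]_w (S_ n w * S_ n w) <= n%:R.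
Proof.
elim: n => [|n IH].
  by rewrite /S_; under eq_Rintegral do rewrite big_ord0 mul0r; rewrite exp_cst.
have SD : \int[P]_w (S_ n w * D n w) = 0.
  rewrite /S_; under eq_Rintegral do rewrite mulr_suml.
  rewrite (@exp_sum _ _ _ _ n (fun i w => D i w * D n w)).
    by rewrite big1// => i _; exact: D_orthogonal.
  by move=> i; exact: bmeasM.
have -> : (fun w => S_ n.+1 w * S_ n.+1 w) =
    (fun w => S_ n w * S_ n w + (2 * (S_ n w * D n w) + D n w * D n w)).
  by apply/funext => w; rewrite /S_ big_ord_recr/=; ring.
rewrite expD; [|exact: bmeasM|]; last first.
  by apply: bmeasD; [apply: bmeasZ|]; exact: bmeasM.
rewrite expD; [|by apply: bmeasZ; exact: bmeasM|exact: bmeasM].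
rewrite expZ; last exact: bmeasM.
rewrite SD mulr0 add0r -natr1 lerD//.
rewrite -[leRHS](exp_cst P); apply: exp_le; [exact: bmeasM|exact: bmeas_cst|].
move=> w; rewrite (le_trans (ler_norm _))// normrM.
by rewrite -[leRHS]mulr1 ler_pM.
Qed.

(** The first moment is bounded by the second through |x| <= e + x^2 / e, with [e] left free. *)
Let exp_meanS n (e : R) : 0 < e ->
  \int[P]_w `|n.+1%:R^-1 * S_ n.+1 w| <= e + e^-1 * n.+1%:R^-1.
Proof.
move=> e0.
have aux (u v : R) : u * v <= u * u + v * v by nra.
have n0 : 0 < n.+1%:R^-1 :> R by rewrite invr_gt0 ltr0n.
apply: (@le_trans _ _ (\int[P]_w (e + e^-1 * n.+1%:R^-1 * n.+1%:R^-1 * (S_ n.+1 w * S_ n.+1 w)))).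
  apply: exp_le.
  - by apply: bmeas_norm; exact: bmeasZ.
  - by apply: bmeasD; [exact: bmeas_cst|apply: bmeasZ; exact: bmeasM].
  move=> w; set x := S_ n.+1 w; set r := n.+1%:R^-1.
  rewrite -(ler_pM2l e0) mulrDr -!mulrA [e * (e^-1 * _)]mulrA divff ?mul1r ?gt_eqF//.
  have -> : r * (r * (x * x)) = `|r * x| * `|r * x|.
    by rewrite -normrM ger0_norm -?expr2 ?sqr_ge0// expr2; ring.
  exact: aux.
rewrite expD; [|exact: bmeas_cst|by apply: bmeasZ; exact: bmeasM].
rewrite exp_cst expZ; last exact: bmeasM.
rewrite lerD2l -[leRHS]mulr1 -[leLHS]mulrA ler_wpM2l//.
  by rewrite mulr_ge0// ltW// invr_gt0.
by rewrite ler_pdivrMl ?ltr0n// mulr1.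
Qed.

Variable V : Omega -> R.
Hypothesis bV : bmeas V.
Hypothesis KV : L1cvg P (fun n => kprob (alpha n) B) V.

(** The error is the mean of the [D i] plus the mean of the [kprob (alpha i) B - V]. The former is
    small by the second moment bound, the latter by Cesaro's theorem applied to the real sequence of
    L^1 distances. *)
Lemma empirical_L1cvg :
  L1cvg P (fun n w => n.+1%:R^-1 * \sum_(i < n.+1) I i w) V.
Proof.
apply/L1cvgP => e e0.
have e3 : 0 < e / 3 by rewrite divr_gt0.
have /cvgrPdist_le/(_ _ e3)[N1 _ HN1] := cesaro KV.
have [N2 HN2] : exists N, forall n, (N <= n)%N -> (e / 3)^-1 * n.+1%:R^-1 <= e / 3.
  have [m] := ltr_add_invr (mulr_gt0 e3 e3); rewrite add0r => /ltW em.
  exists m => n mn; rewrite ler_pdivrMl//; apply: le_trans em.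
  by rewrite lef_pV2 ?posrE ?ltr0n// ler_nat ltnS.
exists (maxn N1 N2) => n; rewrite geq_max => /andP[N1n N2n].
pose K w := n.+1%:R^-1 * \sum_(i < n.+1) `|kprob (alpha i) B w - V w|.
have bKV i : bmeas (fun w => `|kprob (alpha i) B w - V w|).
  by apply: bmeas_norm; exact: bmeasB.
have bK' : bmeas K.
  by apply: bmeasZ; apply: (@bmeas_sum _ _ _ n.+1 (fun i w => `|kprob (alpha i) B w - V w|)).
apply: (@le_trans _ _ (\int[P]_w (`|n.+1%:R^-1 * S_ n.+1 w| + K w))).
  apply: exp_le.
  - by apply: bmeas_norm; apply: bmeasB => //; apply: bmeasZ; exact: bmeas_sum.
  - by apply: bmeasD => //; apply: bmeas_norm; exact: bmeasZ.
  move=> w.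
  have -> : n.+1%:R^-1 * (\sum_(i < n.+1) I i w) - V w =
     n.+1%:R^-1 * S_ n.+1 w + n.+1%:R^-1 * (\sum_(i < n.+1) (kprob (alpha i) B w - V w)).
    rewrite -mulrDr -big_split/= [in RHS](eq_bigr (fun i : 'I_n.+1 => I i w - V w)); last first.
      by move=> i _; rewrite /D; ring.
    rewrite sumrB sumr_const card_ord mulrBr -[V w *+ _]mulr_natl mulrA mulVf ?mul1r//.
  rewrite (le_trans (ler_normD _ _))// lerD2l normrM ger0_norm ?invr_ge0 ?ler0n//.
  by rewrite ler_wpM2l ?invr_ge0 ?ler0n// ler_norm_sum.
rewrite expD => //; last by apply: bmeas_norm; exact: bmeasZ.
have E1 := le_trans (exp_meanS n e3) (lerD (lexx _) (HN2 _ N2n)).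
rewrite /K expZ; last by apply: (@bmeas_sum _ _ _ n.+1 (fun i w => `|kprob (alpha i) B w - V w|)).
rewrite (@exp_sum _ _ _ _ n.+1 (fun i w => `|kprob (alpha i) B w - V w|))//.
have := HN1 n N1n; rewrite sub0r normrN /arithmetic_mean /series/= big_mkord => /(le_trans (ler_norm _)) => E2.
have eE : e / 3 + e / 3 + e / 3 = e by field.
by rewrite -[leRHS]eE lerD.
Qed.

End empirical_means.

Section limn_sup_shift.
Context {R : realType}.
Implicit Types u : nat -> R^o.

(** Boundedness makes the suprema of the tails converge, so the limsup is a true limit and ignores a
    shift of the index. *)
Lemma limn_sup_shift u m :
  bounded_fun u -> limn_sup (fun k => u (k + m)%N) = limn_sup u.
Proof.
move=> bu; rewrite /limn_sup.
have -> : sups (fun k => u (k + m)%N) = fun k => sups u (k + m)%N.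
  apply/funext => n; congr sup; apply/seteqP; split=> _ [k /= nk <-].
    by exists (k + m)%N => //=; rewrite leq_add2r.
  exists (k - m)%N => /=; first by rewrite leq_subRL ?(leq_trans _ nk) ?leq_addl// addnC.
  by rewrite subnK// (leq_trans _ nk)// leq_addl.
apply/cvg_lim => //.
have := @cvg_sups_inf _ u (bounded_fun_has_ubound bu) (bounded_fun_has_lbound bu).
by move=> h; rewrite -/(limn_sup u) limn_supE// cvg_shiftn.
Qed.

End limn_sup_shift.

Section tail_limit.
Context {R : realType} d d' {Omega : measurableType d} {S : measurableType d'}.
Variables (P : probability Omega R) (X : nat -> Omega -> S).
Hypothesis mX : forall n, measurable_fun setT (X n).

(* The terms [M k] may be discarded one by one without changing the limsup, and
   [M k] only depends on the coordinates from [k] on. *)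
Lemma tail_version (M : nat -> Omega -> R) (V : Omega -> R) :
  (forall k w, 0 <= M k w <= 1) ->
  (forall k (C : set R), measurable C ->
     sigma_seq X [set i | (k <= i)%N] (M k @^-1` C)) ->
  bmeas V ->
  (forall k, \int[P]_w `|M k w - V w| <= (2 ^ k.+1)%:R^-1 * (2 ^ k.+1)%:R^-1) ->
  exists W : Omega -> R, [/\ forall w, 0 <= W w <= 1,
    forall C : set R, measurable C -> tail_sigma X (W @^-1` C) &
    \int[P]_w `|V w - W w| = 0].
Proof.
move=> M01 MX bV MV.
have bM w : bounded_fun (M ^~ w : nat -> R^o).
  exists 1; split; first exact: num_real.
  move=> x x1 k _ /=; have /andP[? ?] := M01 k w.
  by rewrite ger0_norm// (le_trans _ (ltW x1)).
have mM k : measurable_fun setT (M k).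
  by move=> _ C mC; rewrite setTI; apply: (sigma_seq_measurable mX); exact: MX.
pose W w : R := limn_sup (M ^~ w).
have Wcvg w : sups (M ^~ w) @ \oo --> (W w : R^o).
  rewrite /W limn_supE//; apply: cvg_sups_inf;
    [exact: bounded_fun_has_ubound|exact: bounded_fun_has_lbound].
have W01 w : 0 <= W w <= 1.
  apply/andP; split.
    apply: limr_ge; first by apply/cvg_ex; exists (W w : R^o); exact: Wcvg.
    apply: nearW => n; have /andP[M0 _] := M01 n w; apply: (le_trans M0).
    apply: ub_le_sup; last by exists n => /=.
    exact/has_ubound_sdrop/bounded_fun_has_ubound.
  apply: limr_le; first by apply/cvg_ex; exists (W w : R^o); exact: Wcvg.
  apply: nearW => n; apply: ge_sup; first by exists (M n w), n => /=.
  by move=> _ [k /= _ <-]; have /andP[] := M01 k w.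
have tW (C : set R) : measurable C -> tail_sigma X (W @^-1` C).
  move=> mC m _.
  pose G := \bigcup_(k in [set i | (m <= i)%N])
     preimage_set_system [set: Omega] (X k) measurable.
  (* Measurability for a sub-sigma-field is expressed as measurability on the same set equipped with
     that sigma-field. *)
  have : measurable_fun [set: g_sigma_algebraType G]
      (fun w : g_sigma_algebraType G => limn_sup (fun k => M (k + m)%N w) : R).
    apply: (@measurable_fun_limn_sup _ (g_sigma_algebraType G) R setT (fun k w => M (k + m)%N w)).
    - by move=> w _; exists 1 => _ [k _ <-]; have /andP[] := M01 (k + m)%N w.
    - by move=> w _; exists 0 => _ [k _ <-]; have /andP[] := M01 (k + m)%N w.
    move=> k _ D mD; rewrite setTI; apply: (@sigma_seqS _ _ _ _ X [set i | (k + m <= i)%N]).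
      by move=> i /= ; apply: leq_trans; rewrite leq_addl.
    exact: MX.
  move=> /(_ measurableT C mC); rewrite setTI.
  rewrite (_ : (fun w => limn_sup _) = W)//.
  by apply/funext => w; exact: (limn_sup_shift m (bM w)).
exists W; split => //.
have mW : measurable_fun setT W.
  move=> _ C mC; rewrite setTI; apply: (sigma_seq_measurable mX).
  exact: (tW _ mC 0%N).
have bW : bmeas W.
  by split=> //; exists 1 => w; have /andP[? ?] := W01 w; rewrite ger0_norm.
have bMV k : bmeas (fun w => M k w - V w).
  apply: bmeasB => //; split => //; exists 1 => w.
  by have /andP[? ?] := M01 k w; rewrite ger0_norm.
(* Markov's inequality at level 2^-(k+1), against a mean of at most 4^-(k+1), leaves probability
   2^-(k+1). This is summable, so Borel-Cantelli applies. *)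
pose F k := [set w | (2 ^ k.+1)%:R^-1 <= `|M k w - V w|].
have mF k : measurable (F k) by apply: measurable_ge; exact: (bmeas_norm (bMV k)).1.
have p2 k : 0 < (2 ^ k.+1)%:R^-1 :> R by rewrite invr_gt0 ltr0n expn_gt0.
have PF k : (P (F k) <= (0 + (1 / (2 ^ k.+1)%:R)%:E))%E.
  rewrite add0e -[P (F k)]fineK ?lee_fin ?div1r; last exact: fin_num_measure.
  apply: (le_trans (markov_bmeas P (bMV k) (p2 k))).
  by rewrite ler_pdivrMl.
have N0 : P (lim_sup_set F) = 0%E.
  apply: lim_sup_set_cvg0 => //.
  apply: (@le_lt_trans _ _ (\sum_(0 <= i <oo) (0 + (1 / (2 ^ i.+1)%:R)%:E))%E).
    by apply: lee_nneseries => // k _; exact: PF.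
  apply: (le_lt_trans (epsilon_trick xpredT _ _)) => //.
  by rewrite eseries0// add0e ltry.
have mN : measurable (lim_sup_set F).
  by apply: bigcapT_measurable => n; apply: bigcup_measurable => k _; exact: mF.
have VW w : ~ lim_sup_set F w -> V w = W w.
  move=> nN; suff MVw : (M ^~ w : nat -> R^o) @ \oo --> (V w : R^o).
    by rewrite /W (cvg_limn_inf_sup MVw).2.
  have [m Hm] : exists m, forall k, (m <= k)%N -> `|M k w - V w| < (2 ^ k.+1)%:R^-1.
    apply: contrapT => H; apply: nN => m _; apply: contrapT => H'.
    apply: H; exists m => k mk; rewrite ltNge; apply/negP => Fk.
    by apply: H'; exists k.
  apply/cvgrPdist_le => e e0; have [j] := ltr_add_invr e0; rewrite add0r => /ltW je.
  exists (maxn m j) => // k /=; rewrite geq_max => /andP[mk jk].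
  rewrite distrC (le_trans (ltW (Hm _ mk)))// (le_trans _ je)//.
  rewrite lef_pV2 ?posrE ?ltr0n ?expn_gt0// ler_nat.
  by rewrite (leq_trans _ (ltnW (ltn_expl k.+1 (ltnSn 1))))// ltnS.
have [_ [N VN]] := bV.
have bI : bmeas (fun w => (N + 1) * \1_(lim_sup_set F) w).
  by apply: bmeasZ; exact: bmeas_indic.
apply/eqP; rewrite eq_le Rintegral_ge0// andbT.
apply: (@le_trans _ _ (\int[P]_w ((N + 1) * \1_(lim_sup_set F) w))).
  apply: exp_le => //; first by apply: bmeas_norm; exact: bmeasB.
  move=> w; rewrite indicE; case: (boolP (w \in _)) => [_|].
    rewrite mulr1 (le_trans (ler_normB _ _))// lerD//.
    by have /andP[? ?] := W01 w; rewrite ger0_norm.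
  by rewrite notin_setE => /VW ->; rewrite subrr normr0 mulr0.
by rewrite expZ ?exp_indic ?N0 ?mulr0//; exact: bmeas_indic.
Qed.

End tail_limit.

Section tail_measurable_limit.
Context {R : realType} d d' {Omega : measurableType d} {S : measurableType d'}.
Variables (P : probability Omega R) (X : nat -> Omega -> S).
Hypothesis mX : forall n, measurable_fun setT (X n).
Variable alpha : nat -> R.-pker Omega ~> S.
Hypothesis pX : predictive P X alpha.
Variables (B : set S) (mB : measurable B).

(** The block keeps the divisor [k + j] of the full mean, so the two differ exactly by the first [k]
    terms, of total size at most k / (k + j). *)
Lemma block_mean_approx (V : Omega -> R) (e : R) k : bmeas V ->
  L1cvg P (fun n => kprob (alpha n) B) V -> 0 < e ->
  exists j, \int[P]_w
    `|(k + j)%:R^-1 * \sum_(i < j) \1_(X (k + i)%N @^-1` B) w - V w| <= e.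
Proof.
move=> bV KV e0.
have bI n : bmeas (\1_(X n @^-1` B) : _ -> R).
  by apply: bmeas_indic; rewrite -[X in measurable X]setTI; exact: mX.
have e2 : 0 < e / 2 by rewrite divr_gt0.
have /L1cvgP/(_ _ e2)[N HN] := empirical_L1cvg mX pX mB bV KV.
have k1 : 0 < k.+1%:R :> R by rewrite ltr0n.
have [m] := ltr_add_invr (divr_gt0 e2 k1); rewrite add0r => /ltW me.
(* [N] serves the empirical mean, [m] makes the dropped head at most [e / 2], and [k] keeps the
   start of the block within range. *)
pose n := maxn N (maxn m k); pose j := (n.+1 - k)%N.
have kn : (k <= n.+1)%N by rewrite ltnW// ltnS !leq_max leqnn !orbT.
have nE : n.+1 = (k + j)%N by rewrite subnKC.
exists j; rewrite -nE.
pose A w : R := n.+1%:R^-1 * \sum_(i < n.+1) \1_(X i @^-1` B) w.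
have HA : \int[P]_w `|A w - V w| <= e / 2 := HN n (leq_maxl _ _).
pose C w : R := n.+1%:R^-1 * \sum_(i < k) \1_(X i @^-1` B) w.
have bC : bmeas C by apply: bmeasZ; exact: (@bmeas_sum _ _ _ _ (fun i => \1_(X i @^-1` B))).
have bA : bmeas A by apply: bmeasZ; exact: (@bmeas_sum _ _ _ _ (fun i => \1_(X i @^-1` B))).
have -> : (fun w => `|n.+1%:R^-1 * \sum_(i < j) \1_(X (k + i)%N @^-1` B) w - V w|) =
          (fun w => `|(A w - V w) - C w|).
  apply/funext => w; congr `|_|; rewrite /A [X in X * _]/= /C.
  rewrite [in X in (_ * X - _) - _]nE big_split_ord/= mulrDr.
  set a := _ * \sum_(i < k) _; set b := _ * \sum_(i < j) _.
  by rewrite addrAC [a + b]addrC addrK.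
have Ce w : `|C w| <= e / 2.
  have n0 : 0 <= n.+1%:R^-1 :> R by rewrite invr_ge0.
  rewrite normrM ger0_norm//.
  apply: (@le_trans _ _ (m.+1%:R^-1 * k.+1%:R)); last by rewrite -ler_pdivlMr.
  apply: ler_pM => //.
    by rewrite lef_pV2 ?posrE ?ltr0n// ler_nat ltnS !leq_max leqnn orbT.
  apply: (@le_trans _ _ (\sum_(i < k) 1)); last first.
    by rewrite sumr_const card_ord ler_nat.
  apply: (le_trans (ler_norm_sum _ _ _)); apply: ler_sum => i _.
  by rewrite indicE; case: (_ \in _); rewrite ?normr1 ?normr0.
apply: (@le_trans _ _ (\int[P]_w (`|A w - V w| + e / 2))).
  apply: exp_le.
  - by apply: bmeas_norm; apply: bmeasB => //; exact: bmeasB.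
  - by apply: bmeasD; [apply: bmeas_norm; exact: bmeasB|exact: bmeas_cst].
  by move=> w; rewrite (le_trans (ler_normB _ _))// lerD2l.
rewrite expD; [|by apply: bmeas_norm; exact: bmeasB|exact: bmeas_cst].
by rewrite exp_cst [leRHS](splitr e) lerD2r.
Qed.

Lemma tail_limit (V : Omega -> R) : measurable_fun setT V ->
  cvg_in_probability P (fun n => kprob (alpha n) B) V ->
  exists W : Omega -> R, [/\ forall w, 0 <= W w <= 1,
    forall C : set R, measurable C -> tail_sigma X (W @^-1` C) &
    L1cvg P (fun n => kprob (alpha n) B) W].
Proof.
move=> mV pV.
(* The limit in probability may leave [[0, 1]]; truncating it never increases its distance to a
   value of [kprob], which lies in [[0, 1]]. *)
pose V' w := Num.max 0 (Num.min 1 (V w)).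
have V'01 w : 0 <= V' w <= 1.
  by rewrite /V' le_max lexx/= ge_max ler01 ge_min lexx.
have mV' : measurable_fun setT V'.
  by apply: measurable_maxr => //; exact: measurable_minr.
have bV' : bmeas V'.
  by split=> //; exists 1 => w; have /andP[? ?] := V'01 w; rewrite ger0_norm.
have mK n := measurable_kprob (alpha n) mB.
have VV' n w : `|kprob (alpha n) B w - V' w| <= `|kprob (alpha n) B w - V w|.
  have /andP[K0 K1] := kprob01 (alpha n) w mB; rewrite /V'.
  have [v1|v1] := leP 1 (V w).
    rewrite max_r// [leRHS]distrC [leLHS]distrC !ger0_norm; lra.
  by have [v0|v0] := leP 0 (V w); rewrite // !ger0_norm; lra.
have KV' : L1cvg P (fun n => kprob (alpha n) B) V'.
  apply: (@cvg_in_probability_L1 _ _ _ _ 1).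
  - by move=> n; exact: measurable_funB.
  - move=> n w; have /andP[? ?] := V'01 w; have /andP[? ?] := kprob01 (alpha n) w mB.
    by rewrite ler_norml; apply/andP; split; lra.
  move=> e e0; apply: (@squeeze_cvge _ _ _ _ (cst 0%E) _ _ _ _ _ (pV e e0)); last exact: cvg_cst.
  apply: nearW => n; rewrite measure_ge0/= le_measure ?inE//.
  - by apply: measurable_ge; apply: measurableT_comp => //; exact: measurable_funB.
  - by apply: measurable_ge; apply: measurableT_comp => //; exact: measurable_funB.
  by move=> w /= /le_trans; apply.
have p2 k : 0 < (2 ^ k.+1)%:R^-1 * (2 ^ k.+1)%:R^-1 :> R.
  by rewrite mulr_gt0// invr_gt0 ltr0n expn_gt0.
have /choice[j Hj] := fun k => block_mean_approx k bV' KV' (p2 k).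
pose M k w : R := (k + j k)%:R^-1 * \sum_(i < j k) \1_(X (k + i)%N @^-1` B) w.
have [W [W01 tW VW]] : exists W : Omega -> R, [/\ forall w, 0 <= W w <= 1,
    forall C : set R, measurable C -> tail_sigma X (W @^-1` C) &
    \int[P]_w `|V' w - W w| = 0].
  apply: (@tail_version _ _ _ _ _ P X mX M) => //.
    move=> k w; rewrite /M mulr_ge0 ?invr_ge0 ?sumr_ge0//=.
    (* When [k + j k] is zero, the inverse is zero by convention and so is [M k]. *)
    have [->|j0] := posnP (k + j k)%N; first by rewrite invr0 mul0r.
    rewrite ler_pdivrMl ?ltr0n// mulr1.
    apply: (@le_trans _ _ (\sum_(i < j k) 1)).
      by apply: ler_sum => i _; rewrite indicE; case: (_ \in _).
    by rewrite sumr_const card_ord ler_nat leq_addl.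
  move=> k C mC.
  pose G := \bigcup_(k in [set i | (k <= i)%N])
     preimage_set_system [set: Omega] (X k) measurable.
  suff [mM _] : @bmeas R _ (g_sigma_algebraType G) (M k : g_sigma_algebraType G -> R).
    by have := mM measurableT C mC; rewrite setTI.
  apply: bmeasZ; apply: (@bmeas_sum _ (g_sigma_algebraType G) _ (j k)
    (fun i => \1_(X (k + i)%N @^-1` B))) => i.
  apply: (@bmeas_indic _ (g_sigma_algebraType G)).
  by apply: (@sigma_seq_preimage _ _ _ _ X) => //=; rewrite leq_addr.
exists W; split=> //; apply/L1cvgP => e e0.
have /L1cvgP/(_ e e0)[N HN] := KV'; exists N => n /HN.
have mW : measurable_fun setT W.
  move=> _ C mC; rewrite setTI; apply: (sigma_seq_measurable mX).
  exact: (tW _ mC 0%N).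
have bW : bmeas W.
  by split=> //; exists 1 => w; have /andP[? ?] := W01 w; rewrite ger0_norm.
have bK := bmeas_kprob (alpha n) mB.
apply: le_trans; rewrite -[leRHS]addr0 -VW -expD; last 2 first.
- by apply: bmeas_norm; exact: bmeasB.
- by apply: bmeas_norm; exact: bmeasB.
apply: exp_le.
- by apply: bmeas_norm; exact: bmeasB.
- by apply: bmeasD; apply: bmeas_norm; exact: bmeasB.
by move=> w; exact: ler_distD.
Qed.

End tail_measurable_limit.

(** * Setwise limits of probability measures *)

Section setwise_limit.
Context {R : realType} d {S : measurableType d}.
Variable nu : nat -> probability S R.
Let r n (B : set S) : R := fine (nu n B).
Hypothesis nu_cvg : forall B, measurable B -> cvgn (r ^~ B : nat -> R^o).
Let L (B : set S) : R := limn (r ^~ B : nat -> R^o).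

Let rE n B : measurable B -> nu n B = (r n B)%:E.
Proof. by move=> mB; rewrite fineK// fin_num_measure. Qed.

Let r01 n B : measurable B -> 0 <= r n B <= 1.
Proof. by move=> mB; rewrite -!lee_fin -rE// measure_ge0 probability_le1. Qed.

Let r_le n A B : measurable A -> measurable B -> A `<=` B -> r n A <= r n B.
Proof. by move=> mA mB AB; rewrite -lee_fin -!rE// le_measure ?inE. Qed.

Let r_setU n A B : measurable A -> measurable B -> r n (A `|` B) <= r n A + r n B.
Proof.
move=> mA mB; rewrite -lee_fin EFinD -!rE//; last exact: measurableU.
exact: measureU2.
Qed.

Let r_setUD n A B : measurable A -> measurable B -> [disjoint A & B] ->
  r n (A `|` B) = r n A + r n B.
Proof.
move=> mA mB AB; apply: EFin_inj; rewrite EFinD -!rE//; last exact: measurableU.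
by rewrite measureU//; exact/disj_set2P.
Qed.

Let L_cvg B : measurable B -> r ^~ B @ \oo --> (L B : R^o).
Proof. by move=> mB; exact: nu_cvg. Qed.

Let L_near B e : measurable B -> 0 < e ->
  exists N, forall n, (N <= n)%N -> `|r n B - L B| < e.
Proof.
move=> mB e0; have /cvgrPdist_lt/(_ _ e0)[N _ HN] := L_cvg mB.
by exists N => n /HN; rewrite distrC.
Qed.

Let L_le A B : measurable A -> measurable B -> A `<=` B -> L A <= L B.
Proof.
by move=> mA mB AB; apply: ler_lim; [exact: nu_cvg..|apply: nearW => n; exact: r_le].
Qed.

Let L_le1 B : measurable B -> L B <= 1.
Proof.
move=> mB; apply: limr_le; first exact: nu_cvg.
by apply: nearW => n; have /andP[] := r01 n mB.
Qed.

(* Gliding hump: if [L (B k)] stays above [e], pick alternately indices [k_j]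
   and [n_j] so that [nu n_j] puts almost mass [e] on the hump
   [B k_j `\` B k_{j+1}]; along the union [C] of every other hump,
   [nu n_j C] oscillates. *)
Lemma setwise_limit_cvg0 (B : nat -> set S) (e : R) :
  (forall k, measurable (B k)) -> (forall j k, (j <= k)%N -> B k `<=` B j) ->
  \bigcap_k B k = set0 -> 0 < e -> exists k, L (B k) <= e.
Proof.
move=> mB dB B0 e0; apply: contrapT => nB.
have LB k : e < L (B k).
  by rewrite ltNge; apply/negP => ?; apply: nB; exists k.
have e8 : 0 < e / 8 by rewrite divr_gt0.
(* Measurability is a premise inside the statement so that the choice function is total on pairs;
   [(0, 0)] is a dummy value. *)
have step (kE : nat * set S) : exists nk : nat * nat, measurable kE.2 ->
    [/\ (kE.1 <= nk.1)%N, (kE.1 < nk.2)%N, `|r nk.1 kE.2 - L kE.2| < e / 8,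
     e - e / 8 < r nk.1 (B kE.1) & r nk.1 (B nk.2) < e / 8].
  case: kE => k E /=; have [mE|?] := pselect (measurable E); last by exists (0, 0)%N.
  have [N1 HN1] := L_near mE e8.
  have [N2 HN2] := L_near (mB k) e8.
  pose n := maxn k (maxn N1 N2).
  (* Once [n] is fixed, continuity from above of the single measure [nu n] provides the next
     index. *)
  have rB0 : (nu n \o B) k @[k --> \oo] --> 0%E.
    rewrite -(measure0 (nu n)) -B0; apply: nonincreasing_cvg_mu => //.
    - by rewrite (le_lt_trans (probability_le1 _ _))// ltry.
    - exact: bigcapT_measurable.
    - by move=> i j ij; apply/subsetPset; exact: dB.
  have /fine_cvgP[_ /cvgrPdist_lt/(_ _ e8)[M _ HM]] := rB0.
  exists (n, maxn k.+1 M) => _; split => /=.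
  - exact: leq_maxl.
  - exact: leq_maxl.
  - by apply: HN1; rewrite !leq_max leqnn orbT.
  - have := HN2 n; rewrite !leq_max leqnn !orbT => /(_ isT).
    rewrite ltr_norml => /andP[+ _]; have := LB k; lra.
  - have := HM (maxn k.+1 M) (leq_maxr _ _); rewrite /= sub0r normrN.
    exact: le_lt_trans (ler_norm _).
have {step}/choice[g Hg] := step.
(* A state holds the current index, the union of the humps taken so far, and a flag that flips at
   each stage and tells whether the next hump is taken. *)
pose next (s : nat * set S * bool) := let k' := (g s.1).2 in
  (k', if s.2 then s.1.2 `|` (B s.1.1 `\` B k') else s.1.2, ~~ s.2).
pose st j := iter j next (0%N, set0, true).
pose k j := (st j).1.1; pose E j := (st j).1.2; pose n j := (g (st j).1).1.
have bE j : (st j).2 = ~~ odd j by elim: j => //= j ->.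
have mE j : measurable (E j).
  elim: j => [|j IH]; first exact: measurable0.
  rewrite /E/=; case: ifP => // _; apply: measurableU => //; exact: measurableD.
have kS j : k j.+1 = (g (st j).1).2 by [].
have ES j : E j.+1 = if ~~ odd j then E j `|` (B (k j) `\` B (k j.+1)) else E j.
  by rewrite -bE.
have {}Hg j := Hg (st j).1 (mE j).
have kj j : (j <= k j)%N.
  by elim: j => // j IH; have [_ + _ _ _] := Hg j; rewrite kS; exact: leq_trans.
have nj j : (j <= n j)%N by have [+ _ _ _ _] := Hg j; exact: leq_trans.
have BS j : B (k j.+1) `<=` B (k j).
  by apply: dB; have [_ /ltnW + _ _ _] := Hg j.
have EES j : E j `<=` E j.+1 by rewrite ES; case: ifP => _; [exact: subsetUl|exact: subset_refl].
have EE i j : (i <= j)%N -> E i `<=` E j.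
  move=> /subnK <-; elim: (j - i)%N => // m IH.
  exact: subset_trans IH (EES _).
have EB j : E j `&` B (k j) = set0.
  elim: j => [|j IH]; first by rewrite set0I.
  rewrite ES -subset0 => x [+ Bx]; case: ifP => _.
    by move=> [Ex|[]//]; rewrite -IH; split=> //; exact: BS.
  by move=> Ex; rewrite -IH; split=> //; exact: BS.
have EEB i j : E (i + j)%N `<=` E j `|` B (k j).
  move: j; elim: i => [|i IH] j; first exact: subsetUl.
  rewrite addSnnS => x /IH; rewrite ES => -[|/BS]; last by right.
  by case: ifP => _; [move=> [?|[? _]]; [left|right]|left].
pose C := \bigcup_j E j.
have mC : measurable C by exact: bigcupT_measurable.
have CEB j : C `<=` E j `|` B (k j).
  move=> x [i _ Ex]; apply: (EEB i).
  by apply: EE Ex; rewrite leq_addr.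
(* The hump is taken: [E j] has mass at least [L (E j) - e / 8], and the disjoint hump at least
   [e - e / 8 - e / 8]. *)
have Cup j : ~~ odd j -> L (E j) + e / 8 * 5 <= r (n j) C.
  move=> oj; have [_ _ HE HB HB'] := Hg j.
  rewrite -/(n j) -/(k j) -/(E j) -kS in HE HB HB'.
  have H1 : r (n j) (E j `|` (B (k j) `\` B (k j.+1))) <= r (n j) C.
    apply: r_le => //; first by apply: measurableU => //; exact: measurableD.
    by move=> x Ex; exists j.+1 => //; rewrite ES oj.
  rewrite r_setUD// in H1; last 2 first.
  - exact: measurableD.
  - by apply/disj_set2P; rewrite -subset0 => x [Ex [Bx _]]; rewrite -(EB j).
  have H2 : r (n j) (B (k j)) <= r (n j) (B (k j) `\` B (k j.+1)) + r (n j) (B (k j.+1)).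
    rewrite -r_setUD//; last 2 first.
    - exact: measurableD.
    - by apply/disj_set2P; rewrite setIC setICA setICr setI0.
    apply: r_le => //; first by apply: measurableU => //; exact: measurableD.
    by move=> x Bx; have [?|?] := pselect (B (k j.+1) x); [right|left].
  move: HE; rewrite ltr_norml => /andP[HE _].
  have -> : e / 8 * 5 = - (e / 8) + (e - e / 8 - e / 8) by field.
  lra.
(* The hump is skipped: [C] is covered by [E j] and [B (k j.+1)], of masses at most
   [L (E j) + e / 8] and [e / 8]. *)
have Cdn j : odd j -> r (n j) C <= L (E j) + e / 8 * 2.
  move=> oj; have [_ _ HE _ HB'] := Hg j.
  rewrite -/(n j) -/(E j) -kS in HE HB'.
  have H1 : r (n j) C <= r (n j) (E j `|` B (k j.+1)).
    apply: r_le => //; first exact: measurableU.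
    by have := CEB j.+1; rewrite ES oj.
  have := r_setU (n j) (mE j) (mB (k j.+1)).
  move: HE; rewrite ltr_norml => /andP[_ HE].
  lra.
have LEcvg : cvgn (fun j => L (E j) : R^o).
  apply: nondecreasing_is_cvgn; first by move=> i j ij; apply: L_le => //; exact: EE.
  by exists 1 => _ [j _ <-]; exact: L_le1.
pose l : R := limn (fun j => L (E j) : R^o).
(* The gap 3e/8 between the two bounds exceeds the four errors e/16 made when [L (E _)] is replaced
   by [l] and [r _ C] by [L C], at [j] and [j.+1]. *)
have e16 : 0 < e / 16 by rewrite divr_gt0.
have /cvgrPdist_lt/(_ _ e16)[J1 _ HJ1] : (fun j => L (E j)) @ \oo --> (l : R^o) by [].
have [J2 HJ2] := L_near mC e16.
pose j := (maxn J1 J2).*2.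
have j1 : (J1 <= j)%N by rewrite (leq_trans (leq_maxl J1 J2))// /j -addnn leq_addr.
have j2 : (J2 <= j)%N by rewrite (leq_trans (leq_maxr J1 J2))// /j -addnn leq_addr.
have oj : ~~ odd j by rewrite odd_double.
have := Cup j oj; have := @Cdn j.+1 oj.
have := HJ1 j j1; have := HJ1 j.+1 (leqW j1).
have := HJ2 (n j) (leq_trans j2 (nj j)).
have := HJ2 (n j.+1) (leq_trans j2 (leq_trans (leqnSn _) (nj j.+1))).
rewrite /= !ltr_norml => /andP[? ?] /andP[? ?] /andP[? ?] /andP[? ?].
lra.
Qed.

End setwise_limit.

(** * Standard Borel spaces as retracts of the line *)

Section ternary_code.
Context {R : realType}.
Implicit Types (b : nat -> bool) (t : R).

(** Only the digits 0 and 2 occur, as in the Cantor set: the later digits contribute at most 1/3, so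
    the threshold 2/3 decides the first one without ambiguity. *)
Definition code_partial b n : R := \sum_(m < n) 2 * (b m)%:R / 3 ^+ m.+1.

Definition code b : R := limn (code_partial b : nat -> R^o).

(** It removes the leading digit of a code. Being total, it lets digits be read off at every real
    number. *)
Definition shift_digit t : R := 3 * t - 2 * (2 / 3 <= t)%R%:R.

Definition digit m t : bool := 2 / 3 <= iter m shift_digit t.

Lemma code_partialS b n :
  code_partial b n.+1 = (2 * (b 0%N)%:R + code_partial (b \o S) n) / 3.
Proof.
rewrite /code_partial big_ord_recl/= expr1 [RHS]mulrDl mulr_suml; congr (_ + _).
by apply: eq_bigr => m _; rewrite /= /bump/= add1n exprS invfM; ring.
Qed.

Lemma code_partial01 b n : 0 <= code_partial b n <= 1.
Proof.
elim: n b => [|n IH] b; first by rewrite /code_partial big_ord0 lexx ler01.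
by rewrite code_partialS; have /andP[] := IH (b \o S); case: (b 0%N) => /=; lra.
Qed.

Lemma is_cvg_code_partial b : cvgn (code_partial b : nat -> R^o).
Proof.
apply: nondecreasing_is_cvgn; last first.
  by exists 1 => _ [n _ <-]; have /andP[] := code_partial01 b n.
apply/nondecreasing_seqP => n; rewrite /code_partial big_ord_recr/= lerDl.
by rewrite divr_ge0 ?mulr_ge0 ?exprn_ge0.
Qed.

Lemma code01 b : 0 <= code b <= 1.
Proof.
apply/andP; split; [apply: limr_ge|apply: limr_le]; (try exact: is_cvg_code_partial);
  by apply: nearW => n; have /andP[] := code_partial01 b n.
Qed.

Lemma codeS b : code b = (2 * (b 0%N)%:R + code (b \o S)) / 3.
Proof.
apply/cvg_lim => //; rewrite -cvg_shiftS/=.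
under eq_fun do rewrite code_partialS.
apply: cvgM; last exact: cvg_cst.
apply: (@cvgD R R^o); first exact: cvg_cst.
exact: is_cvg_code_partial.
Qed.

Lemma code_digit b m : digit m (code b) = b m.
Proof.
have d0 b' : (2 / 3 <= code b') = b' 0%N.
  rewrite codeS; have /andP[? ?] := code01 (b' \o S).
  by case: (b' 0%N) => /=; [apply/idP|apply/negP]; lra.
elim: m b => [|m IH] b; first exact: d0.
rewrite -[b m.+1]/((b \o S) m) -IH /digit iterSr; congr (_ <= iter m _ _).
by rewrite /shift_digit d0 [code b]codeS; field.
Qed.

Lemma measurable_digit m : measurable [set t | digit m t].
Proof.
apply: measurable_ge; elim: m => [|m IH]; first exact: measurable_id.
rewrite (_ : iter m.+1 shift_digit =
    fun x => 3 * iter m shift_digit x -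
      2 * \1_[set t | 2 / 3 <= iter m shift_digit t] x).
  apply: measurable_funB; apply: measurable_funM => //.
  by apply: measurable_indic; exact: measurable_ge.
apply/funext => x; rewrite /= {1}/shift_digit; congr (_ - 2 * _%:R).
by rewrite mem_setE.
Qed.

Lemma measurable_code d (T : measurableType d) (b : T -> nat -> bool) :
  (forall m, measurable [set x | b x m]) ->
  measurable_fun setT (fun x => code (b x)).
Proof.
move=> mb; apply: (@measurable_fun_cvg _ _ _ setT (fun n x => code_partial (b x) n)).
  move=> n.
  rewrite (_ : (fun x => _) = fun x => \sum_(m < n) 2 * (3 ^+ m.+1)^-1 * \1_[set x | b x m] x).
    by apply: measurable_sum => m; apply: measurable_funM => //; exact: measurable_indic.
  apply/funext => x; apply: eq_bigr => m _.
  by rewrite indicE mem_setE mulrAC.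
by move=> x _; exact: is_cvg_code_partial.
Qed.

End ternary_code.

Lemma bigcup_countType_measurable d (T : measurableType d) (I : countType)
    (Q : set I) (F : I -> set T) :
  (forall i, measurable (F i)) -> measurable (\bigcup_(i in Q) F i).
Proof.
move=> mF; rewrite bigcup_mkcond; apply: countable_bigcupT_measurable => //.
by move=> i; case: ifP.
Qed.

Lemma measurable_Prop d (T : measurableType d) (Q : Prop) :
  measurable [set _ : T | Q].
Proof.
have [q|q] := pselect Q.
  by have -> : [set _ : T | Q] = setT by apply/seteqP; split.
by have -> : [set _ : T | Q] = set0 by apply/seteqP; split.
Qed.

(** The decoder must be Borel on the whole line, whatever the set of codes looks like. So it takes a
    limit on an explicit set [G]: the reals whose digits name some ball at every scale, and only
    balls with compatible centres. These are countably many conditions, and they force the named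
    centres to form a Cauchy sequence. *)
Lemma polish_decode (R : realType) (T : metricType R) (t0 : T) : polish T ->
  exists (bits : T -> nat -> bool) (psi : R -> T),
    [/\ forall m, open [set x | bits x m],
        forall U, open U -> measurable (psi @^-1` U) &
        forall x, psi (code (bits x)) = x].
Proof.
move=> [Tcomplete [D cD dD]].
pose r n : R := (2 ^ n)%:R^-1.
have r0 n : 0 < r n by rewrite invr_gt0 ltr0n expn_gt0.
have small e : 0 < e -> exists n, r n < e.
  move=> e0; have [n] := ltr_add_invr e0; rewrite add0r => ne; exists n.
  by rewrite (le_lt_trans _ ne)// lef_pV2 ?posrE ?ltr0n ?expn_gt0// ler_nat ltn_expl.
have r_dec m n : (m <= n)%N -> r n <= r m.
  by move=> mn; rewrite lef_pV2 ?posrE ?ltr0n ?expn_gt0// ler_nat leq_exp2l.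
have open_ball (z : T) e : open [set y | mdist y z < e].
  rewrite openE => y /= yz; apply/nbhs_ballP; exists (e - mdist y z) => /=.
    by rewrite subr_gt0.
  move=> x; rewrite ballEmdist/= => yx; rewrite (le_lt_trans (metric_triangle _ y _))//.
  by rewrite metric_sym; lra.
have [dn dnP] : exists dn : nat -> T, forall x e, 0 < e -> exists j, mdist x (dn j) < e.
  have [f injf] := elimT (@countable_injP _ D) cD.
  (* Indices missed by the injection [f] get the default [t0]; an extra point does not harm
     density. *)
  exists (fun j => xget t0 [set x | D x /\ f x = j]) => x e e0.
  have [y [yx Dy]] : [set y | mdist y x < e] `&` D !=set0.
    by apply: dD => //; exists x => /=; rewrite mdistxx.
  exists (f y); case: xgetP => [z _ [Dz fz]|/(_ y)]; last by case.
  by rewrite (injf _ _ _ _ fz) ?inE// metric_sym.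
pose bits (x : T) m : bool :=
  if unpickle m is Some (n, j) then mdist x (dn j) < r n else false.
pose A (n j : nat) (t : R) : bool := digit (pickle (n, j)) t.
have bitsA n j x : A n j (code (bits x)) = (mdist x (dn j) < r n).
  by rewrite /A code_digit /bits pickleK.
pose G := [set t | (forall n, exists j, A n j t) /\
  forall n j n' j', A n j t -> A n' j' t -> mdist (dn j) (dn j') < r n + r n'].
have limG t : G t -> exists y, forall n j, A n j t -> mdist y (dn j) <= r n.
  move=> [/choice[j Aj] GA]; pose u n := dn (j n).
  have : cauchy (u @ \oo).
    apply: cauchy_exP => e e0.
    have [n ne] := small _ (divr_gt0 e0 (ltr0Sn _ 1)); exists (u n), n => // m /= nm.
    rewrite ballEmdist/=; apply: (lt_le_trans (GA n _ m _ (Aj _) (Aj _))).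
    by have := r_dec _ _ nm; lra.
  move=> /Tcomplete[y uy]; exists y => n k Ak; apply/ler_addgt0Pl => e e0.
  have e2 := divr_gt0 e0 (ltr0Sn R 1).
  have /cvg_ballP/(_ _ e2)[M1 _ HM1] := uy.
  have [M2 M2e] := small _ e2.
  pose m := maxn M1 M2.
  have := HM1 m (leq_maxl _ _); rewrite /= ballEmdist/= => yu.
  have := GA _ _ _ _ (Aj m) Ak; have := r_dec _ _ (leq_maxr M1 M2 : (M2 <= m)%N).
  have := metric_triangle y (u m) (dn k); rewrite -/(u m); lra.
pose psi t := if pselect (G t) is left tG then sval (cid (limG t tG)) else t0.
have psiG t n j : G t -> A n j t -> mdist (psi t) (dn j) <= r n.
  by move=> tG; rewrite /psi; case: pselect => // tG'; case: cid => /= y; exact.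
have psiNG t : ~ G t -> psi t = t0 by move=> tG; rewrite /psi; case: pselect.
have mA n j : measurable [set t | A n j t] by exact: measurable_digit.
have mG : measurable G.
  have -> : G = (\bigcap_n \bigcup_j [set t | A n j t]) `&`
     \bigcap_(p in [set p : (nat * nat) * (nat * nat) |
        ~ mdist (dn p.1.2) (dn p.2.2) < r p.1.1 + r p.2.1])
       ~` ([set t | A p.1.1 p.1.2 t] `&` [set t | A p.2.1 p.2.2 t]).
    apply/seteqP; split=> t [G1 G2]; split.
    - by move=> n _; have [j] := G1 n; exists j.
    - by move=> [[n j] [n' j']] /= np [? ?]; apply: np; exact: G2.
    - by move=> n; have [j _ ?] := G1 n I; exists j.
    - move=> n j n' j' Aj Aj'; apply: contrapT => np.
      by apply: (G2 ((n, j), (n', j')) np).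
  apply: measurableI.
    by apply: bigcapT_measurable => n; exact: bigcupT_measurable.
  rewrite -[X in measurable X]setCK setC_bigcap; apply: measurableC.
  apply: bigcup_countType_measurable => p; rewrite setCK.
  exact: measurableI.
exists bits, psi; split.
- move=> m; rewrite /bits; case: (unpickle m) => [[n j]|]; first exact: open_ball.
  by have -> : [set x : T | false] = set0; [apply/seteqP; split|exact: open0].
- move=> U oU.
  (* One named ball witnesses [psi t] in [U]: its closed ball contains [psi t], hence lies in the
     [e]-ball around [psi t] as soon as [r n < e / 2]. *)
  have -> : psi @^-1` U = (G `&` \bigcup_(p in [set p : nat * nat |
        forall z, mdist (dn p.2) z <= r p.1 -> U z]) [set t | A p.1 p.2 t])
      `|` (~` G `&` [set _ | U t0]).
    apply/seteqP; split=> t.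
      have [tG Ut|tG] := pselect (G t); last by rewrite /= psiNG//; right.
      left; split => //; move: oU; rewrite openE => /(_ _ Ut)/nbhs_ballP[e /= e0 eU].
      have [n ne] := small _ (divr_gt0 e0 (ltr0Sn _ 1)); have [j Aj] := tG.1 n.
      exists (n, j) => //= z dz; apply: eU; rewrite ballEmdist/=.
      have := psiG _ _ _ tG Aj; have := metric_triangle (psi t) (dn j) z; lra.
    move=> [[tG [[n j] /= nU Aj]]|[tG Ut]] /=; last by rewrite psiNG.
    by apply: nU; rewrite metric_sym; exact: psiG.
  apply: measurableU; apply: measurableI => //.
  - by apply: bigcup_countType_measurable.
  - exact: measurableC.
  - exact: measurable_Prop.
- move=> x; have Gx : G (code (bits x)).
    split=> [n|n j n' j'].
      by have [j xj] := dnP x _ (r0 n); exists j; rewrite bitsA.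
    rewrite !bitsA => ? ?; rewrite (le_lt_trans (metric_triangle _ x _))//.
    by rewrite metric_sym ltrD.
  apply: mdist_positivity; apply/eqP; rewrite eq_le mdist_ge0 andbT.
  apply/ler_addgt0Pl => e e0; rewrite addr0.
  have [n ne] := small _ (divr_gt0 e0 (ltr0Sn _ 1)).
  have [j xj] := dnP x _ (r0 n).
  have Aj : A n j (code (bits x)) by rewrite bitsA.
  have := psiG _ _ _ Gx Aj; have := metric_triangle (psi (code (bits x))) (dn j) x.
  rewrite (metric_sym (dn j)); lra.
Qed.

(** A decoded point outside the range of [i] is sent to [point]; this case distinction is measurable
    because the range is Borel. *)
Lemma standard_borel_retract (R : realType) d (S : measurableType d) :
  standard_borel R S -> exists (phi : S -> R) (psi : R -> S),
    [/\ measurable_fun setT phi, measurable_fun setT psi,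
        forall x, 0 <= phi x <= 1 & cancel phi psi].
Proof.
move=> [T [i [pT iinj mrange mS]]].
have [bits [psi [obits mpsi psiK]]] := polish_decode (i point) pT.
have mpsiB (C : set T) : <<s open >> C -> measurable (psi @^-1` C).
  move: C; apply: smallest_sub; last exact: mpsi.
  split=> [|C mC|F mF]; first by rewrite preimage_set0.
    by rewrite setTD preimage_setC; exact: measurableC.
  by rewrite preimage_bigcup; exact: bigcupT_measurable.
pose phi x : R := code (bits (i x)).
pose psi' t := xget point [set x | i x = psi t].
have psi'E t x : i x = psi t -> psi' t = x.
  move=> ix; apply: iinj; rewrite ix /psi'.
  by case: xgetP => [y _ //|/(_ x)/=]; rewrite ix.
have psi'N t : ~ range i (psi t) -> psi' t = point.
  by move=> nt; rewrite /psi'; case: xgetP => // y _ /= yt; case: nt; exists y.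
exists phi, psi'; split.
- apply: measurable_code => m; rewrite mS.
  exists [set y | bits y m]; last by rewrite setTI.
  exact: sub_sigma_algebra.
- move=> _ B mB; rewrite setTI; move: (mB); rewrite mS => -[C mC CB].
  have -> : psi' @^-1` B = psi @^-1` (C `&` range i) `|`
      (~` (psi @^-1` range i) `&` [set _ | B point]).
    apply/seteqP; split=> t.
      have [[x _ xt]|tN] := pselect (range i (psi t)).
        rewrite /= (psi'E _ _ xt) -CB => -[_ Cx]; left; split; last by exists x.
        by rewrite -xt.
      by rewrite /= psi'N//; right.
    move=> [[Ct [x _ xt]]|[tN Bp]]; last by rewrite /= psi'N.
    by rewrite /= (psi'E _ _ xt) -CB; split=> //=; rewrite xt.
  apply: measurableU; first by rewrite preimage_setI; apply: measurableI; exact: mpsiB.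
  apply: measurableI; first by apply: measurableC; exact: mpsiB.
  exact: measurable_Prop.
- by move=> x; exact: code01.
- by move=> x; apply: psi'E; rewrite psiK.
Qed.

(** * Random laws from quantile functions *)

Section random_law.
Context {R : realType} d d' {T : measurableType d} {S : measurableType d'}.
Variables (U : probability (measurableTypeR R) R) (g : T * measurableTypeR R -> S).
Hypothesis mg : measurable_fun setT g.

Let mg1 t : measurable_fun setT (fun u => g (t, u)).
Proof. exact: measurableT_comp. Qed.

Definition random_law (t : T) : {measure set S -> \bar R} :=
  distribution U (mfun_Sub (mem_set (mg1 t))).

Lemma measurable_random_law B : measurable B -> measurable_fun setT (random_law ^~ B).
Proof.
move=> mB; have mgB : measurable (g @^-1` B) by rewrite -[X in measurable X]setTI; exact: mg.
have := measurable_fun_xsection U mgB; congr (measurable_fun _ _).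
by apply/funext => t /=; rewrite xsectionE.
Qed.

HB.instance Definition _ :=
  isKernel.Build _ _ _ _ _ random_law measurable_random_law.

Let random_lawT t : random_law t setT = 1%E.
Proof. exact: probability_setT. Qed.

HB.instance Definition _ :=
  Kernel_isProbability.Build _ _ _ _ _ random_law random_lawT.

Definition random_law_pker : R.-pker T ~> S := random_law.

End random_law.

Section quantile.
Context {R : realType} d {T : measurableType d}.
Variable F : rat -> T -> R.

(* The clauses [0 <= q] and [1 <= q] keep the set bounded below and nonempty,
   as the infimum is [0] by convention otherwise. *)
Definition quantile (p : T * measurableTypeR R) : measurableTypeR R :=
  inf [set ratr q | q in [set q : rat | 0 <= q /\ (p.2 <= F q p.1 \/ 1 <= q)]].

(** The strict inequality turns the infimum into an existential over rationals, that is, a countable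
    union. *)
Lemma quantile_lt p x : (quantile p < x) <->
  exists q : rat, [/\ ratr q < x, 0 <= q & p.2 <= F q p.1 \/ 1 <= q].
Proof.
split.
  move=> /inf_lt[|_ [q [q0 qF] <-] qx]; last by exists q.
  by exists (ratr 1), 1 => //; split => //; right.
move=> [q [qx q0 qF]]; apply: le_lt_trans qx; apply: ge_inf; last by exists q.
by exists 0 => _ [q' [q'0 _] <-]; rewrite ler0q.
Qed.

Hypothesis mF : forall q, measurable_fun setT (F q).

Lemma measurable_quantile : measurable_fun setT quantile.
Proof.
apply: (measurability _ (RGenInftyO.measurableE R)) => //.
move=> _ [_ [x ->] <-]; rewrite setTI.
rewrite (_ : quantile @^-1` _ = \bigcup_(q in [set q : rat | ratr q < x /\ 0 <= q])
    ([set p | 0 <= F q p.1 - p.2] `|` [set _ | 1 <= q])); last first.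
  apply/seteqP; split=> p /=.
    rewrite in_itv/= => /quantile_lt[q [qx q0 qF]]; exists q => //=.
    by rewrite subr_ge0.
  move=> [q /= [qx q0]]; rewrite subr_ge0 => qF.
  by rewrite in_itv/=; apply/quantile_lt; exists q.
apply: bigcup_countType_measurable => q; apply: measurableU; last exact: measurable_Prop.
apply: measurable_ge; apply: measurable_funB; last exact: measurable_snd.
by apply: measurableT_comp => //; exact: measurable_fst.
Qed.

Variable U : probability (measurableTypeR R) R.
Hypothesis U01 : forall c : R, 0 <= c <= 1 -> U [set u | u <= c] = c%:E.
Hypothesis F01 : forall q t, 0 <= F q t <= 1.
Hypothesis F0 : forall q t, q < 0 -> F q t = 0.
Hypothesis F1 : forall q t, 1 <= q -> F q t = 1.

(** Up to the two boundary clauses, absorbed by [F0] and [F1], the event is the union over [q < x]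
    of the half-lines [u <= F q t]. Half-lines are nested whatever the order of their endpoints, so
    the mass is a supremum even if [F] is not monotone in [q]. *)
Lemma random_law_quantile t (x : R) : random_law U measurable_quantile t `]-oo, x[%classic =
  (sup [set F q t | q in [set q | ratr q < x]])%:E.
Proof.
set H := sup _.
have [q0 q0x] : exists q : rat, ratr q < x.
  have : x - 1 < x by rewrite ltrBlDr ltrDl.
  by move=> /rat_in_itvoo[q]; rewrite in_itv/= => /andP[_ qx]; exists q.
have FH q : ratr q < x -> F q t <= H.
  move=> qx; apply: ub_le_sup; last by exists q.
  by exists 1 => _ [q' _ <-]; have /andP[] := F01 q' t.
have H0 : 0 <= H by have /andP[h _] := F01 q0 t; rewrite (le_trans h)// FH.
have H1 : H <= 1.
  apply: ge_sup; first by exists (F q0 t), q0.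
  by move=> _ [q _ <-]; have /andP[] := F01 q t.
have mu_le (c : R) : measurable [set u : measurableTypeR R | u <= c].
  by rewrite (_ : [set _ | _] = [set` `]-oo, c]])//; apply/seteqP; split=> u /=; rewrite in_itv.
have -> : random_law U measurable_quantile t `]-oo, x[%classic =
  U ((fun u => quantile (t, u)) @^-1` `]-oo, x[%classic) by [].
have mq : measurable ((fun u => quantile (t, u)) @^-1` `]-oo, x[%classic).
  rewrite -[X in measurable X]setTI.
  by apply: (measurableT_comp measurable_quantile (pair1_measurable _)).
apply/eqP; rewrite eq_le; apply/andP; split.
  move: H1; rewrite le_eqVlt => /orP[/eqP ->|H1].
    exact: probability_le1.
  (* As [H < 1], no [q >= 1] lies below [x], since [F q t] would be 1; hence the event is contained
     in [u <= H]. *)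
  rewrite -U01; last by rewrite H0 ltW.
  apply: le_measure; rewrite ?inE//.
  move=> u /=; rewrite in_itv/= => /quantile_lt[q [qx q0' [/= uF|q1]]].
    by rewrite (le_trans uF)// FH.
  by move: (FH _ qx); rewrite F1// leNgt H1.
suff Fq q : ratr q < x -> ((F q t)%:E <= U ((fun u => quantile (t, u)) @^-1` `]-oo, x[%classic))%E.
  have fin : U ((fun u => quantile (t, u)) @^-1` `]-oo, x[%classic) \is a fin_num.
    by rewrite ge0_fin_numE// (le_lt_trans (probability_le1 _ _))// ltry.
  rewrite -[X in (_ <= X)%E]fineK// lee_fin.
  apply: ge_sup; first by exists (F q0 t), q0.
  by move=> _ [q qx <-]; rewrite -lee_fin fineK// Fq.
move=> qx; have [q_0|q_0] := ltP q 0; first by rewrite F0.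
rewrite -U01//; apply: le_measure; rewrite ?inE//.
by move=> u /= uF; rewrite in_itv/=; apply/quantile_lt; exists q; split=> //; left.
Qed.

End quantile.

Lemma uniform_prob_le {R : realType} (c : R) : 0 <= c <= 1 ->
  uniform_prob (@ltr01 R) [set u | u <= c] = c%:E.
Proof.
move=> /andP[c0 c1]; rewrite /uniform_prob integral_uniform_pdf.
rewrite (_ : _ `&` _ = `[0, c]%classic); last first.
  apply/seteqP; split=> u /=; rewrite !in_itv/=; first by move=> [-> /andP[->]].
  by move=> /andP[-> uc]; rewrite uc (le_trans uc c1).
rewrite (eq_integral (cst 1%E)); last first.
  move=> u; rewrite inE/= in_itv/= => /andP[u0 uc].
  by rewrite /uniform_pdf u0 (le_trans uc c1)/= subr0 invr1.
rewrite integral_cst//= mul1e lebesgue_measure_itv/= lte_fin.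
case: ltP => [_|c0']; first by rewrite sube0.
by have -> : c = 0 by apply/eqP; rewrite eq_le c0 c0'.
Qed.

(** * The limiting random probability measure *)

Section limit_law.
Context {R : realType} d d' {Omega : measurableType d} {S : measurableType d'}.
Variables (P : probability Omega R) (X : nat -> {RV P >-> S}).
Variable alpha : nat -> R.-pker Omega ~> S.
Hypothesis pX : predictive P X alpha.
Hypothesis L1 : forall B, measurable B -> exists W : Omega -> R,
  bmeas W /\ L1cvg P (fun n => kprob (alpha n) B) W.

Let K n B := kprob (alpha n) B.

Lemma exp_L1cvg_le (Y : nat -> Omega -> R) Z : (forall n, bmeas (Y n)) -> bmeas Z ->
  L1cvg P Y Z -> (fun n => \int[P]_w Y n w) @ \oo --> (\int[P]_w Z w : R^o).
Proof.
move=> bY bZ /L1cvgP YZ; apply/cvgrPdist_le => e e0; have [N HN] := YZ e e0.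
exists N => // n /= /HN; apply: le_trans; rewrite distrC -expB//.
by apply: exp_norm; exact: bmeasB.
Qed.

(** The mean of [K n C] is the probability that [X n] lies in [C], and these laws converge setwise.
    The gliding hump gives one [k] valid for all large [n], the uniformity behind every exchange of
    limits below. *)
Lemma predictive_vanish (B : nat -> set S) (e : R) :
  (forall k, measurable (B k)) -> (forall j k, (j <= k)%N -> B k `<=` B j) ->
  \bigcap_k B k = set0 -> 0 < e ->
  exists k, \forall n \near \oo, \int[P]_w K n (B k) w <= e.
Proof.
move=> mB dB B0 e0.
pose nu n : probability S R := distribution P (X n).
have nuE n C : measurable C -> fine (nu n C) = \int[P]_w K n C w.
  by move=> mC; rewrite /K (exp_predictive pX).
have nu_cvg C : measurable C -> cvgn (fun n => fine (nu n C) : R^o).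
  move=> mC; have [W [bW KW]] := L1 mC.
  under eq_fun do rewrite nuE//.
  apply/cvg_ex; exists (\int[P]_w W w : R^o); apply: exp_L1cvg_le => // n.
  exact: bmeas_kprob.
have e2 : 0 < e / 2 by rewrite divr_gt0.
have [k Hk] := setwise_limit_cvg0 nu_cvg mB dB B0 e2; exists k.
have /cvgrPdist_lt/(_ _ e2) := nu_cvg _ (mB k).
apply: filterS => n; rewrite -nuE// ltr_norml => /andP[+ _].
move: Hk; rewrite [in X in _ -> _ -> _ <= X](splitr e).
set l := limn _; set r := fine _; lra.
Qed.

Section distribution_function.
Variables (phi : S -> R) (F : rat -> Omega -> R) (kappa : R.-pker Omega ~> measurableTypeR R).
Hypothesis mphi : measurable_fun setT phi.
Hypothesis bF : forall q, bmeas (F q).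
Hypothesis F01 : forall q w, 0 <= F q w <= 1.
Hypothesis FL1 : forall q, L1cvg P (fun n => K n [set s | phi s <= ratr q]) (F q).
Hypothesis kappaF : forall w (x : R), kappa w `]-oo, x[%classic =
  (sup [set F q w | q in [set q | ratr q < x]])%:E.

Let mphi_lt (x : R) : measurable [set s | phi s < x].
Proof.
rewrite (_ : [set s | phi s < x] = phi @^-1` `]-oo, x[%classic); last first.
  by apply/seteqP; split=> s /=; rewrite in_itv.
by rewrite -[X in measurable X]setTI; exact: mphi.
Qed.

Let mphi_le (x : R) : measurable [set s | phi s <= x].
Proof.
rewrite (_ : [set s | phi s <= x] = phi @^-1` `]-oo, x]%classic); last first.
  by apply/seteqP; split=> s /=; rewrite in_itv.
by rewrite -[X in measurable X]setTI; exact: mphi.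
Qed.

(** Let [Z] be the limit for [phi < x]. Each [F q] with [q < x] is at most [Z] almost surely, and
    countably many null sets are discarded; conversely [Z - F q] is controlled by a thin strip below
    [x], small in mean uniformly in [n]. *)
Let L1cvg_lt (x : R) :
  L1cvg P (fun n => K n (phi @^-1` `]-oo, x[%classic)) (kprob kappa `]-oo, x[%classic).
Proof.
rewrite (_ : phi @^-1` _ = [set s | phi s < x]); last first.
  by apply/seteqP; split=> s /=; rewrite in_itv.
set E := [set s | phi s < x]; have mE : measurable E := mphi_lt x.
pose A q := [set s | phi s <= ratr q :> R]; have mA q : measurable (A q) := mphi_le _.
have [Z [bZ KZ]] := L1 mE.
have mI : measurable (`]-oo, x[%classic : set (measurableTypeR R)) by exact: measurable_itv.
set H := kprob kappa _.
have bH : bmeas H by exact: bmeas_kprob.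
have HE w : H w = sup [set F q w | q in [set q | ratr q < x]] by rewrite /H /kprob kappaF.
have H01 w : 0 <= H w <= 1 by exact: kprob01.
have FH q w : ratr q < x -> F q w <= H w.
  move=> qx; rewrite HE; apply: ub_le_sup; last by exists q.
  by exists 1 => _ [q' _ <-]; have /andP[] := F01 q' w.
have bK n B : measurable B -> bmeas (K n B) by exact: bmeas_kprob.
pose h q w := Num.max 0 (F q w - Z w).
have bh q : bmeas (h q).
  have [mD [M DM]] := bmeasB (bF q) bZ.
  split; first exact: measurable_maxr.
  exists M => w; rewrite /h; case: (leP 0 (F q w - Z w)) => _; first exact: DM.
  by rewrite normr0 (le_trans _ (DM w)).
have Ph q : ratr q < x -> P [set w | 0 < h q w] = 0%E.
  move=> qx; apply: exp_eq0_null => //; first by move=> w; rewrite /h le_max lexx.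
  apply/eqP; rewrite eq_le; apply/andP; split; last first.
    by apply: Rintegral_ge0 => w _; rewrite /h le_max lexx.
  apply/ler_addgt0Pl => e e0; rewrite addr0.
  have e2 : 0 < e / 2 by rewrite divr_gt0.
  have /L1cvgP/(_ _ e2)[N1 HN1] := KZ.
  have /L1cvgP/(_ _ e2)[N2 HN2] := FL1 q.
  pose n := maxn N1 N2.
  have := HN1 n (leq_maxl _ _); have := HN2 n (leq_maxr _ _) => E1 E2.
  have bKZ : bmeas (fun w => `|K n E w - Z w|).
    by apply: bmeas_norm; apply: bmeasB => //; exact: bK.
  have bKF : bmeas (fun w => `|K n (A q) w - F q w|).
    by apply: bmeas_norm; apply: bmeasB => //; exact: bK.
  apply: (@le_trans _ _ (\int[P]_w (`|K n (A q) w - F q w| + `|K n E w - Z w|))).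
    apply: exp_le => //; first exact: bmeasD.
    move=> w; rewrite /h ge_max addr_ge0//=.
    have : K n (A q) w <= K n E w.
      by apply: kprob_le => // s /= /le_lt_trans; apply.
    have := ler_norm (- (K n (A q) w - F q w)); rewrite normrN.
    have := ler_norm (K n E w - Z w); lra.
  by rewrite expD// [leRHS](splitr e) lerD.
pose N := \bigcup_(q in [set q : rat | ratr q < x]) [set w | 0 < h q w].
have mh q : measurable [set w | 0 < h q w].
  rewrite (_ : [set w | 0 < h q w] = h q @^-1` `]0, +oo[%classic).
    by rewrite -[X in measurable X]setTI; apply: (bh q).1 => //; exact: measurable_itv.
  by apply/seteqP; split=> w /=; rewrite in_itv/= andbT.
have mN : measurable N by exact: bigcup_countType_measurable.
have PN : P N = 0%E.
  apply: measure_negligible => //.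
  pose N' n := if unpickle n is Some q then
      (if (ratr q < x)%R then [set w | 0 < h q w] else set0) else set0.
  have NN' : N `<=` \bigcup_n N' n.
    move=> w [q /= qx hq]; exists (pickle q); first exact: I.
    by rewrite /N' pickleK qx.
  apply: (negligibleS NN'); apply: negligible_bigcup => n; rewrite /N'.
  case: unpickle => [q|]; last exact: negligible_set0.
  case: ifP => [qx|_]; last exact: negligible_set0.
  by apply/negligibleP => //; exact: Ph.
have ZH : \int[P]_w `|Z w - H w| = 0.
  apply/eqP; rewrite eq_le; apply/andP; split; last exact: Rintegral_ge0.
  apply/ler_addgt0Pl => e e0; rewrite addr0.
  have e3 : 0 < e / 3 by rewrite divr_gt0.
  pose B k := [set s | phi s < x] `\` [set s | phi s < x - k.+1%:R^-1].
  have mB k : measurable (B k) by exact: measurableD.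
  have [k Bk] : exists k, \forall n \near \oo, \int[P]_w K n (B k) w <= e / 3.
    apply: predictive_vanish => //.
      move=> i j ij s [sx /= sj]; split=> //= si; apply: sj; apply: (lt_le_trans si).
      by rewrite lerD2l lerN2 lef_pV2 ?posrE ?ltr0n// ler_nat.
    rewrite -subset0 => s Bs; have [/= sx _] := Bs 0%N I.
    have [k] := ltr_add_invr sx; rewrite -ltrBrDr => sk.
    by have [_] := Bs k I; apply.
  (* With [ratr q] inside the strip, the part of [E] missed by [A q] lies in [B k]. *)
  have [q qx] : exists q : rat, x - k.+1%:R^-1 < ratr q < x.
    have : x - k.+1%:R^-1 < x by rewrite ltrBlDr ltrDl invr_gt0.
    by move=> /rat_in_itvoo[q]; rewrite in_itv/= => ?; exists q.
  have /andP[kq qx'] := qx.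
  have /L1cvgP/(_ _ e3)[N1 HN1] := KZ.
  have /L1cvgP/(_ _ e3)[N2 HN2] := FL1 q.
  have [N3 _ HN3] := Bk.
  pose n := maxn N1 (maxn N2 N3).
  have := HN1 n (leq_maxl _ _).
  have := HN2 n; rewrite !leq_max leqnn orbT => /(_ isT).
  have := HN3 n; rewrite /= !leq_max leqnn !orbT => /(_ isT) E3 E2 E1.
  have bKZ : bmeas (fun w => `|K n E w - Z w|).
    by apply: bmeas_norm; apply: bmeasB => //; exact: bK.
  have bKF : bmeas (fun w => `|K n (A q) w - F q w|).
    by apply: bmeas_norm; apply: bmeasB => //; exact: bK.
  have [_ [M ZM]] := bZ.
  have bI : bmeas (fun w => (M + 2) * \1_N w) by apply: bmeasZ; exact: bmeas_indic.
  (* Off [N], [Z - H] lies between 0 and [Z - F q], which is split through [K n E] and [K n (A q)].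
     On the null set [N] the constant [M + 2] is a crude bound. *)
  apply: (@le_trans _ _ (\int[P]_w (((`|K n E w - Z w| + `|K n (A q) w - F q w|) +
      K n (B k) w) + (M + 2) * \1_N w))).
    apply: exp_le.
    - by apply: bmeas_norm; exact: bmeasB.
    - by do 2 (apply: bmeasD; last (try exact: bK; try exact: bI)); exact: bmeasD.
    move=> w; have K0 : 0 <= K n (B k) w by have /andP[] := kprob01 (alpha n) w (mB k).
    rewrite indicE; case: (boolP (w \in N)) => [_|].
      rewrite mulr1 [leRHS]addrC ler_wpDr//; first by rewrite !addr_ge0.
      rewrite (le_trans (ler_normB _ _))// lerD//.
      by have /andP[? ?] := H01 w; rewrite ger0_norm//; lra.
    rewrite notin_setE mulr0 addr0 => nN.
    have FZ q' : ratr q' < x -> F q' w <= Z w.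
      move=> q'x; rewrite leNgt; apply/negP => ZF; apply: nN; exists q' => //=.
      by rewrite /h lt_max subr_gt0 ZF orbT.
    have HZ : H w <= Z w.
      rewrite HE; apply: ge_sup; first by exists (F q w), q.
      by move=> _ [q' q'x <-]; exact: FZ.
    rewrite ger0_norm ?subr_ge0//.
    have KB : K n E w - K n (A q) w <= K n (B k) w.
      have AE : A q `<=` E by move=> s /= /le_lt_trans; apply.
      rewrite /K -kprob_setD//; apply: kprob_le => //; first exact: measurableD.
      move=> s [sx /= sq]; split=> //= sk; apply: sq.
      exact: (ltW (lt_trans sk kq)).
    have := FH q w qx'.
    have := ler_norm (K n (A q) w - F q w).
    have := ler_norm (- (K n E w - Z w)); rewrite normrN; lra.
  rewrite expD; [|by apply: bmeasD; [exact: bmeasD|exact: bK]|exact: bI].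
  rewrite expZ ?exp_indic ?PN ?mulr0 ?addr0//; last exact: bmeas_indic.
  rewrite expD; [|exact: bmeasD|exact: bK].
  rewrite expD//.
  have -> : e = e / 3 + e / 3 + e / 3 by field.
  by rewrite !lerD.
apply/L1cvgP => e e0; have /L1cvgP/(_ _ e0)[M HM] := KZ; exists M => n /HM.
have bKZ : bmeas (fun w => `|K n E w - Z w|).
  by apply: bmeas_norm; apply: bmeasB => //; exact: bK.
have bZH : bmeas (fun w => `|Z w - H w|) by apply: bmeas_norm; exact: bmeasB.
apply: le_trans; rewrite -[leRHS]addr0 -ZH -expD//.
apply: exp_le; [|exact: bmeasD|].
  by apply: bmeas_norm; apply: bmeasB => //; exact: bK.
by move=> w; exact: ler_distD.
Qed.

Lemma limit_law (D : set (measurableTypeR R)) : measurable D ->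
  L1cvg P (fun n => K n (phi @^-1` D)) (kprob kappa D).
Proof.
have mphiD (C : set (measurableTypeR R)) : measurable C -> measurable (phi @^-1` C).
  by move=> mC; rewrite -[X in measurable X]setTI; exact: mphi.
pose G := [set C : set (measurableTypeR R) | measurable C /\
  L1cvg P (fun n => K n (phi @^-1` C)) (kprob kappa C)].
suff : measurable `<=` G by move=> + mD => /(_ _ mD)[].
have bK n B : measurable B -> bmeas (K n B) by exact: bmeas_kprob.
have bk C : measurable C -> bmeas (kprob kappa C) by exact: bmeas_kprob.
have bdist n C : measurable C ->
    bmeas (fun w => `|K n (phi @^-1` C) w - kprob kappa C w|).
  by move=> mC; apply: bmeas_norm; apply: bmeasB; [exact/bK/mphiD|exact: bk].
rewrite [X in X `<=` _]RGenInftyO.measurableE.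
apply: lambda_system_subset => //.
- move=> _ _ [x ->] [y ->]; exists (Num.min x y).
  by apply/seteqP; split=> z /=; rewrite !in_itv/= lt_min => /andP.
- split=> //.
  + split=> //; apply/L1cvgP => e e0; exists 0%N => n _.
    rewrite preimage_setT.
    under eq_Rintegral do rewrite /K !kprob_setT subrr normr0.
    by rewrite exp_cst ltW.
  + move=> A B BA [mA KA] [mB KB]; split; first exact: measurableD.
    have norm4 (a b c e : R) : `|(a - b) - (c - e)| <= `|a - c| + `|b - e|.
      have -> : (a - b) - (c - e) = (a - c) - (b - e) by ring.
      exact: ler_normB.
    apply/L1cvgP => e e0; have e2 : 0 < e / 2 by rewrite divr_gt0.
    have /L1cvgP/(_ _ e2)[N1 HN1] := KA.
    have /L1cvgP/(_ _ e2)[N2 HN2] := KB.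
    exists (maxn N1 N2) => n; rewrite geq_max => /andP[/HN1 E1 /HN2 E2].
    apply: (@le_trans _ _ (\int[P]_w (`|K n (phi @^-1` A) w - kprob kappa A w| +
       `|K n (phi @^-1` B) w - kprob kappa B w|))).
      apply: exp_le; [by apply: bdist; exact: measurableD|by apply: bmeasD; exact: bdist|].
      move=> w; rewrite -[phi @^-1` (A `\` B)]/(phi @^-1` A `\` phi @^-1` B) /K !kprob_setD//; try exact: mphiD.
      exact: preimage_subset.
    by rewrite expD ?[leRHS](splitr e) ?lerD//; exact: bdist.
  (* Three errors: the [K n]-mass of [U] outside [A k], small uniformly in [n]; its [kappa]-mass,
     small by monotone convergence; and the L^1 distance at the fixed set [A k]. *)
  + move=> A ndA GA; have mA k := (GA k).1; have KA k := (GA k).2.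
    have mU : measurable (\bigcup_k A k) by exact: bigcupT_measurable.
    split=> //; apply/L1cvgP => e e0; set U := \bigcup_k A k.
    have e3 : 0 < e / 3 by rewrite divr_gt0.
    have AU k : A k `<=` U by exact: bigcup_sup.
    pose B k := phi @^-1` (U `\` A k).
    have mB k : measurable (B k) by apply: mphiD; exact: measurableD.
    have ndA' i j : (i <= j)%N -> A i `<=` A j by move=> /ndA/subsetPset.
    have dB i j : (i <= j)%N -> B j `<=` B i.
      by move=> ij s [Us nAs]; split=> // As; apply: nAs; exact: ndA' As.
    have [k1 Bk1] : exists k, \forall n \near \oo, \int[P]_w K n (B k) w <= e / 3.
      apply: predictive_vanish => //.
      rewrite -subset0 => s Bs; have [[k _ As] _] := Bs 0%N I.
      by have [_] := Bs k I; apply.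
    have kA : (fun k => \int[P]_w kprob kappa (A k) w) @ \oo --> (\int[P]_w kprob kappa U w : R^o).
      have cv w : (fun k => kappa w (A k)) @ \oo --> kappa w U.
        by apply: nondecreasing_cvg_mu => // i j ij; apply/subsetPset; exact: ndA'.
      have := @cvg_monotone_convergence _ _ R P setT measurableT
        (fun k w => kappa w (A k)) (fun k => measurable_kernel kappa (A k) (mA k))
        (fun _ _ _ => measure_ge0 _ _).
      have nd (w : Omega) : setT w -> nondecreasing_seq (fun k => kappa w (A k)).
        by move=> _ i j ij; apply: le_measure; rewrite ?inE//; exact: ndA'.
      move=> /(_ nd).
      under eq_integral do rewrite (cvg_lim _ (cv _))//.
      under eq_integral do rewrite kprobE//.
      under eq_fun do under eq_integral do rewrite kprobE//.
      have fin C : measurable C -> (\int[P]_w (kprob kappa C w)%:E)%E = (\int[P]_w kprob kappa C w)%:E.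
        move=> mC; rewrite /Rintegral fineK//; apply: integrable_fin_num => //.
        exact: (bmeas_integrable P (bk _ mC)).
      rewrite fin//; under eq_fun do rewrite fin//.
      by move=> /fine_cvgP[].
    have /cvgrPdist_lt/(_ _ e3)[k2 _ Hk2] := kA.
    pose k := maxn k1 k2.
    have /L1cvgP/(_ _ e3)[N1 HN1] := KA k.
    have [N2 _ HN2] := Bk1.
    exists (maxn N1 N2) => n; rewrite geq_max => /andP[/HN1 E1 /HN2/= E2].
    have E3 : \int[P]_w (kprob kappa U w - kprob kappa (A k) w) <= e / 3.
      rewrite expB; [|exact: bk..].
      by have := Hk2 k (leq_maxr _ _); rewrite ltr_norml => /andP[_ /ltW].
    have bkU : bmeas (fun w => kprob kappa U w - kprob kappa (A k) w).
      by apply: bmeasB; exact: bk.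
    apply: (@le_trans _ _ (\int[P]_w ((`|K n (phi @^-1` A k) w - kprob kappa (A k) w| +
       K n (B k1) w) + (kprob kappa U w - kprob kappa (A k) w)))).
      apply: exp_le; first exact: bdist.
        by apply: bmeasD => //; apply: bmeasD; [exact: (bdist n _ (mA k))|exact: (bK n _ (mB k1))].
      move=> w.
      have pAU : phi @^-1` A k `<=` phi @^-1` U by exact: preimage_subset.
      have [mpA mpU] := (mphiD _ (mA k), mphiD _ mU).
      have KB : K n (phi @^-1` U) w - K n (phi @^-1` A k) w <= K n (B k1) w.
        rewrite /K -kprob_setD//.
        rewrite -[_ `\` _]/(phi @^-1` (U `\` A k)); apply: kprob_le => //.
          by apply: mphiD; exact: measurableD.
        by apply: dB; exact: leq_maxl.
      have kU : kprob kappa (A k) w <= kprob kappa U w by exact: kprob_le.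
      have KU : K n (phi @^-1` A k) w <= K n (phi @^-1` U) w.
        exact: kprob_le.
      have h1 := ler_norm (K n (phi @^-1` A k) w - kprob kappa (A k) w).
      have h2 := ler_norm (- (K n (phi @^-1` A k) w - kprob kappa (A k) w)).
      by rewrite normrN in h2; rewrite /= ler_norml; apply/andP; split; lra.
    rewrite expD//; last by apply: bmeasD; [exact: (bdist n _ (mA k))|exact: (bK n _ (mB k1))].
    rewrite expD; [|exact: (bdist n _ (mA k))|exact: (bK n _ (mB k1))].
    have -> : e = e / 3 + e / 3 + e / 3 by field.
    by rewrite !lerD.
move=> _ [x ->]; split; [exact: measurable_itv|exact: L1cvg_lt].
Qed.

End distribution_function.

End limit_law.

(** * From events to bounded functions *)

Section kernel_integral.
Context {R : realType} d d' {T : measurableType d} {S : measurableType d'}.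

Section kernel_at.
Variables (k : R.-pker T ~> S) (w : T).

(** Carries the structure of a probability, so that the expectation lemmas apply to the kernel at a
    fixed [w]. *)
Definition kernel_at : set S -> \bar R := k w.

HB.instance Definition _ := Measure.copy kernel_at (k w).

HB.instance Definition _ :=
  Measure_isProbability.Build _ _ R kernel_at (@prob_kernel _ _ _ _ _ k w).

End kernel_at.

Variables (f : S -> R) (M : R).
Hypotheses (mf : measurable_fun setT f) (M0 : 0 < M) (fM : forall s, `|f s| <= M).

(** The quotient rescales [f] from [[-M, M]] to [[0, 1]], the range required by [layer_approx]. *)
Definition layer m j := [set s | j.+1%:R / m.+1%:R <= (f s + M) / (2 * M)].

Lemma measurable_layer m j : measurable (layer m j).
Proof.
apply: measurable_ge; apply: measurable_funM => //; exact: measurable_funD.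
Qed.

Definition layer_sum (k : R.-pker T ~> S) m w : R :=
  2 * M * (m.+1%:R^-1 * \sum_(j < m.+1) kprob k (layer m j) w) - M.

(** The error bound is the same for all kernels and all [w], so one [m] serves a whole sequence of
    kernels. *)
Lemma rpm_int_layer_sum (k : R.-pker T ~> S) m w :
  `|rpm_int k f w - layer_sum k m w| <= 2 * M * m.+1%:R^-1.
Proof.
have M2 : 0 < 2 * M by rewrite mulr_gt0.
have bf : bmeas f by split=> //; exists M.
pose L s : R := m.+1%:R^-1 * \sum_(j < m.+1) \1_(layer m j) s.
have bI j : bmeas (\1_(layer m j) : S -> R) by apply: bmeas_indic; exact: measurable_layer.
have bS : bmeas (fun s => \sum_(j < m.+1) \1_(layer m j) s : R).
  exact: (@bmeas_sum _ _ _ m.+1 (fun j => \1_(layer m j))).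
have bL : bmeas L by exact: bmeasZ.
have bg : bmeas (fun s => 2 * M * L s - M).
  by apply: bmeasB; [exact: bmeasZ|exact: bmeas_cst].
have -> : layer_sum k m w = \int[kernel_at k w]_s (2 * M * L s - M).
  rewrite expB; [|exact: bmeasZ|exact: bmeas_cst].
  rewrite exp_cst expZ// expZ//.
  rewrite (@exp_sum _ _ _ (kernel_at k w) m.+1 (fun j => \1_(layer m j)))//.
  rewrite /layer_sum; congr (_ * (_ * _) - _); apply: eq_bigr => j _.
  by rewrite exp_indic//; exact: measurable_layer.
rewrite -[rpm_int k f w]/(\int[kernel_at k w]_s f s) -expB//.
rewrite -[leRHS](exp_cst (kernel_at k w)).
apply: (le_trans (exp_norm _ _)); first exact: bmeasB.
apply: exp_le; [by apply: bmeas_norm; exact: bmeasB|exact: bmeas_cst|].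
move=> s; have := fM s; rewrite ler_norml => /andP[f1 f2].
set z := (f s + M) / (2 * M).
have z01 : 0 <= z <= 1.
  apply/andP; split; last by rewrite ler_pdivrMr//; lra.
  by apply: divr_ge0; [lra|exact: ltW].
have := layer_approx m z01.
have -> : f s - (2 * M * L s - M) = 2 * M * (z - L s).
  by rewrite /z; field; rewrite gt_eqF.
have -> : L s = m.+1%:R^-1 * \sum_(k < m.+1) (k.+1%:R / m.+1%:R <= z)%R%:R.
  congr (_ * _); apply: eq_bigr => j _; rewrite indicE; congr (_%:R).
  by congr nat_of_bool; apply/idP/idP; rewrite inE.
by rewrite normrM gtr0_norm// ler_pM2l.
Qed.

Lemma measurable_layer_sum (k : R.-pker T ~> S) m : measurable_fun setT (layer_sum k m).
Proof.
apply: measurable_funB => //; do 2 apply: measurable_funM => //.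
by apply: measurable_sum => j; apply: measurable_kprob; exact: measurable_layer.
Qed.

Lemma measurable_rpm_int (k : R.-pker T ~> S) : measurable_fun setT (rpm_int k f).
Proof.
apply: (measurable_fun_cvg (measurable_layer_sum k)) => w _.
apply/cvgrPdist_le => e e0.
have M2 : 0 < 2 * M by rewrite mulr_gt0.
have [n] := ltr_add_invr (divr_gt0 e0 M2); rewrite add0r => /ltW ne.
exists n => // m /= nm; rewrite (le_trans (rpm_int_layer_sum _ _ _))//.
rewrite -ler_pdivlMl// [leRHS]mulrC (le_trans _ ne)// lef_pV2 ?posrE ?ltr0n//.
by rewrite ler_nat ltnS.
Qed.

Lemma rpm_int_bound (k : R.-pker T ~> S) w : `|rpm_int k f w| <= M.
Proof.
have bf : bmeas f by split=> //; exists M.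
rewrite -[rpm_int k f w]/(\int[kernel_at k w]_s f s).
apply: (le_trans (exp_norm _ bf)); rewrite -[leRHS](exp_cst (kernel_at k w)).
by apply: exp_le => //; [exact: bmeas_norm|exact: bmeas_cst].
Qed.

End kernel_integral.

Lemma L1cvg_rpm_int {R : realType} d d' {T : measurableType d} {S : measurableType d'}
    (P : probability T R) (alpha_ : nat -> R.-pker T ~> S) (alpha : R.-pker T ~> S)
    (f : S -> R) (M : R) :
  measurable_fun setT f -> 0 < M -> (forall s, `|f s| <= M) ->
  (forall B, measurable B ->
     L1cvg P (fun n => kprob (alpha_ n) B) (kprob alpha B)) ->
  L1cvg P (fun n => rpm_int (alpha_ n) f) (rpm_int alpha f).
Proof.
move=> mf M0 fM KB; apply/L1cvgP => e e0.
have M2 : 0 < 2 * M by rewrite mulr_gt0.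
have e3 : 0 < e / 3 by rewrite divr_gt0.
have [m] := ltr_add_invr (divr_gt0 e3 M2); rewrite add0r => /ltW me.
have {}me : 2 * M * m.+1%:R^-1 <= e / 3 by rewrite -ler_pdivlMl// [leRHS]mulrC.
pose A := layer f M m.
have mA j : measurable (A j) by exact: measurable_layer.
pose D n j w := `|kprob (alpha_ n) (A j) w - kprob alpha (A j) w|.
have bD n j : bmeas (D n j).
  by apply: bmeas_norm; apply: bmeasB; exact: bmeas_kprob.
(* Each of the m+1 layers has weight 1/(m+1) in the layer sum, so a bound [e / 3] per layer gives
   [e / 3] in total. *)
have [N HN] : exists N, forall n, (N <= n)%N -> forall j, (j < m.+1)%N ->
    2 * M * \int[P]_w D n j w <= e / 3.
  elim: m.+1 => [|p [N1 HN1]]; first by exists 0%N.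
  have /L1cvgP/(_ _ (divr_gt0 e3 M2))[N2 HN2] := KB _ (mA p).
  exists (maxn N1 N2) => n; rewrite geq_max => /andP[/HN1 h1 /HN2 h2] j.
  rewrite ltnS leq_eqVlt => /orP[/eqP ->|]; last exact: h1.
  by rewrite -ler_pdivlMl// [leRHS]mulrC.
exists N => n /HN Hn.
have br k : bmeas (rpm_int k f : T -> R).
  split; first exact: measurable_rpm_int mf M0 fM k.
  by exists M => w; exact: rpm_int_bound.
have bS : bmeas (fun w => \sum_(j < m.+1) D n j w) by exact: bmeas_sum.
pose c := 2 * M * m.+1%:R^-1.
have c0 : 0 <= c by rewrite mulr_ge0 ?ltW// invr_gt0.
apply: (@le_trans _ _ (\int[P]_w (2 * c + c * \sum_(j < m.+1) D n j w))).
  apply: exp_le.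
  - by apply: bmeas_norm; exact: bmeasB.
  - by apply: bmeasD; [exact: bmeas_cst|exact: bmeasZ].
  move=> w.
  have h1 := rpm_int_layer_sum mf M0 fM (alpha_ n) m w.
  have h2 := rpm_int_layer_sum mf M0 fM alpha m w.
  have h3 : `|layer_sum f M (alpha_ n) m w - layer_sum f M alpha m w| <=
      c * \sum_(j < m.+1) D n j w.
    rewrite /layer_sum opprB addrA subrK -!mulrBr -sumrB mulrA normrM ger0_norm//.
    by rewrite ler_wpM2l// ler_norm_sum.
  rewrite -/c in h1 h2; rewrite distrC in h2.
  have h4 := ler_distD (layer_sum f M (alpha_ n) m w) (rpm_int (alpha_ n) f w)
    (rpm_int alpha f w).
  have h5 := ler_distD (layer_sum f M alpha m w) (layer_sum f M (alpha_ n) m w)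
    (rpm_int alpha f w).
  rewrite (le_trans h4)// mulr_natl mulr2n -[leRHS]addrA; apply: lerD => //.
  by rewrite (le_trans h5)// [leRHS]addrC; apply: lerD.
rewrite expD; [|exact: bmeas_cst|exact: bmeasZ].
rewrite exp_cst expZ// exp_sum//.
have -> : e = 2 * (e / 3) + e / 3 by field.
apply: lerD; first by rewrite ler_pM2l.
rewrite /c mulrAC mulrC ler_pdivrMl ?ltr0n//.
rewrite mulr_sumr; apply: (@le_trans _ _ (\sum_(j < m.+1) e / 3)).
  by apply: ler_sum => j _; exact: Hn.
by rewrite sumr_const card_ord mulr_natl.
Qed.

Lemma sigma_algebra_preimage_cst d (T : measurableType d) (G : set (set T))
    (Y : Type) (y : Y) (C : set Y) : sigma_algebra setT G ->
  G ((fun _ => y) @^-1` C).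
Proof.
move=> sG; rewrite -(sigma_algebra_id sG).
exact: (@measurable_Prop _ (g_sigma_algebraType G) (C y)).
Qed.

Theorem theorem1 (R : realType) (d d' : measure_display)
    (Omega : measurableType d) (P : probability Omega R)
    (S : measurableType d') (hS : standard_borel R S)
    (X : nat -> {RV P >-> S}) (alpha_ : nat -> R.-pker Omega ~> S)
    (halpha : predictive P X alpha_)
    (hcvg : forall f : {mfun S >-> R}, bounded_fun f ->
      exists V : {RV P >-> R},
        cvg_in_probability P (fun n => rpm_int (alpha_ n) f) V) :
  exists alpha : R.-pker Omega ~> S,
    rpm_measurable (tail_sigma X) alpha /\
    forall f : {mfun S >-> R}, bounded_fun f ->
      cvg_in_probability P (fun n => rpm_int (alpha_ n) f) (rpm_int alpha f).
Proof.
have mX n : measurable_fun setT (X n) by [].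
have sT := sigma_algebra_tail_sigma X.
have tailm : tail_sigma X `<=` measurable.
  by move=> A /(_ 0%N I); exact: sigma_seq_measurable.
have L B : measurable B -> exists W : Omega -> R, [/\ forall w, 0 <= W w <= 1,
    forall C : set R, measurable C -> tail_sigma X (W @^-1` C) &
    L1cvg P (fun n => kprob (alpha_ n) B) W].
  move=> mB; have [|V] := hcvg (mindic R mB).
    exists 1; split; first exact: num_real.
    move=> x x1 s _; rewrite /= /mindic/= indicE.
    by case: (_ \in _); rewrite ?normr1 ?normr0 ltW// (lt_trans _ x1).
  rewrite (_ : (fun n => _) = (fun n => kprob (alpha_ n) B)); last first.
    by apply/funext => n; apply/funext => w; exact: rpm_int_indic.
  by apply: tail_limit => //; exact: measurable_funPT.
have tail_bmeas (W : Omega -> R) : (forall w, 0 <= W w <= 1) ->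
    (forall C : set R, measurable C -> tail_sigma X (W @^-1` C)) -> bmeas W.
  move=> W01 tW; split.
    by move=> _ C mC; rewrite setTI; apply: tailm; exact: tW.
  by exists 1 => w; have /andP[? ?] := W01 w; rewrite ger0_norm.
have [phi [psi [mphi mpsi phi01 psiK]]] := standard_borel_retract hS.
(* For [q < 0] and [q >= 1] the version is a constant at every [w], as [random_law_quantile]
   demands; it is the right limit since [phi] takes values in [[0, 1]]. *)
have /choice[F HF] : forall q : rat, exists W : Omega -> R, [/\
    [/\ forall w, 0 <= W w <= 1,
    forall C : set R, measurable C -> tail_sigma X (W @^-1` C) &
    L1cvg P (fun n => kprob (alpha_ n) [set s | phi s <= ratr q]) W],
    q < 0 -> forall w, W w = 0 & 1 <= q -> forall w, W w = 1].
  have L1_cst B (r : R) : (forall n w, kprob (alpha_ n) B w = r) ->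
      L1cvg P (fun n => kprob (alpha_ n) B) (fun=> r).
    move=> Br; apply/L1cvgP => e e0; exists 0%N => n _.
    under eq_Rintegral do rewrite Br subrr normr0.
    by rewrite exp_cst ltW.
  move=> q; have [q0|q0] := ltP q 0.
    exists (fun=> 0); split=> //; last by rewrite leNgt (lt_trans q0 ltr01).
    split=> //; first by move=> w; rewrite lexx ler01.
      by move=> C _; exact: sigma_algebra_preimage_cst.
    apply: L1_cst => n w; rewrite (_ : [set s | _] = set0) ?kprob_set0//.
    rewrite -subset0 => s /= sq; have /andP[s0 _] := phi01 s.
    by have := le_trans s0 sq; rewrite ler0q leNgt q0.
  have [q1|q1] := leP 1 q.
    exists (fun=> 1); split=> //.
    split=> //; first by move=> w; rewrite lexx ler01.
      by move=> C _; exact: sigma_algebra_preimage_cst.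
    apply: L1_cst => n w.
    rewrite (_ : [set s | phi s <= ratr q] = setT) ?kprob_setT//.
    apply/seteqP; split=> // s _ /=; have /andP[_ s1] := phi01 s.
    by rewrite (le_trans s1)// -(rmorph1 (@ratr R)) ler_rat.
  have mB : measurable [set s | phi s <= ratr q].
    rewrite (_ : [set s | _] = phi @^-1` `]-oo, ratr q]%classic); last first.
      by apply/seteqP; split=> s /=; rewrite in_itv.
    by rewrite -[Z in measurable Z]setTI; exact: mphi.
  by have [W HW] := L _ mB; exists W.
have F01 q w : 0 <= F q w <= 1 by have [[]] := HF q.
have tF q (C : set R) : measurable C -> tail_sigma X (F q @^-1` C).
  by have [[_ + _] _ _] := HF q; exact.
have bF q : bmeas (F q) by apply: tail_bmeas => //; exact: tF.
have mF q : measurable_fun setT (F q) by have [] := bF q.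
(* The same quantile map is measurable over [Omega] and over [Omega']: the former makes its law a
   kernel on [Omega], the latter makes that kernel tail measurable. *)
pose Omega' := g_sigma_algebraType (tail_sigma X).
have mF' q : measurable_fun [set: Omega'] (F q : Omega' -> R).
  by move=> _ C mC; rewrite setTI; apply: sub_sigma_algebra; exact: tF.
pose U : probability (measurableTypeR R) R := uniform_prob (@ltr01 R).
have mg := measurableT_comp mpsi (measurable_quantile mF).
have mg' := measurableT_comp mpsi (measurable_quantile mF').
exists (random_law_pker U mg); split.
  move=> B mB C mC; rewrite -(sigma_algebra_id sT).
  have := measurable_random_law U mg' mB measurableT mC.
  by rewrite setTI.
move=> f bf.
have [M [M0 fM]] : exists M : R, 0 < M /\ forall s, `|f s| <= M.
  have [M [_ HM]] := bf; exists (`|M| + 1); split; first by rewrite ltr_wpDl.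
  by move=> s; apply: HM => //; rewrite (le_lt_trans (ler_norm _))// ltrDl.
have mf : measurable_fun setT f by exact: measurable_funPT.
have mr k := measurable_rpm_int mf M0 fM k.
apply: L1cvg_in_probability.
  move=> n; apply: bmeasB; split=> //.
    by exists M => w; exact: rpm_int_bound.
  by exists M => w; exact: rpm_int_bound.
apply: L1cvg_rpm_int mf M0 fM _ => B mB.
have mpB : measurable (psi @^-1` B) by rewrite -[Z in measurable Z]setTI; exact: mpsi.
(* The law of [B] under the image by [psi] is by definition the line law of its preimage, and
   pulling that preimage back by [phi] returns [B]. *)
have := @limit_law _ _ _ _ _ P X alpha_ halpha _ phi F
  (random_law_pker U (measurable_quantile mF)) mphi bF F01 _ _ _ mpB.
rewrite (_ : phi @^-1` (psi @^-1` B) = B); last first.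
  by apply/seteqP; split=> s /=; rewrite psiK.
apply.
- by move=> C /L[W [W01 tW KW]]; exists W; split=> //; exact: tail_bmeas.
- by move=> q; have [[]] := HF q.
- move=> w x; apply: random_law_quantile => //.
  + by move=> c; exact: uniform_prob_le.
  + by move=> q w' q0; have [_ h _] := HF q; exact: h.
  + by move=> q w' q1; have [_ _ h] := HF q; exact: h.
Qed.
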